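(* Let $M$ be a rotational surface in $\mathbb{S}^3_1$ of one of the four types described in the context (spherical $\mathbf{M}_1$, hyperbolic of the first kind $\mathbf{M}_{-1}$, hyperbolic of the second kind, parabolic $\mathbf{M}_0$). Suppose that $M$ is a Weingarten surface whose principal curvatures $\kappa,\lambda$ satisfy $\kappa=f(\lambda)$ for some continuous function $f$, and that $M$ has no umbilical points. Then the parameterization of $M$ with respect to $\lambda$ (that is, with $\lambda$ in place of the arc length $u$ as parameter of the profile curve) is given by one of the following, where $\int(\cdot)\,d\lambda$ denotes an antiderivative in $\lambda$. (i) The spherical rotational surface $\mathbf{M}_1$: $$\mathbf{r}_1(\lambda,v)=\left(y(\lambda)\sin v,\,y(\lambda)\cos v,\,z(\lambda),\,w(\lambda)\right),\quad \lambda\in J\subset\mathbb{R},\ v\in[0,2\pi],$$ $$z(\lambda)=\sqrt{1-y^2(\lambda)}\cosh\phi(\lambda),\quad w(\lambda)=\sqrt{1-y^2(\lambda)}\sinh\phi(\lambda)\quad\text{for }0<y(\lambda)<1,$$ or $$z(\lambda)=\sqrt{y^2(\lambda)-1}\sinh\phi(\lambda),\quad w(\lambda)=\sqrt{y^2(\lambda)-1}\cosh\phi(\lambda)\quad\text{for }y(\lambda)>1,$$ where $$y(\lambda)=c\,e^{\int\frac{d\lambda}{\varepsilon f(\lambda)-\lambda}},\qquad \phi(\lambda)=\phi_0\pm\int\frac{\lambda y^2(\lambda)\,d\lambda}{(y^2(\lambda)-1)(\varepsilon f(\lambda)-\lambda)\sqrt{(\lambda^2-\varepsilon)y^2(\lambda)+\varepsilon}}$$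 with constants $c>0$ and $\phi_0$, $\varepsilon=\pm1$, and $(\lambda^2-\varepsilon)y^2(\lambda)+\varepsilon>0$ on an open interval $\tilde J\subset J$. When $\varepsilon=1$ the surface is spacelike; when $\varepsilon=-1$ it is timelike. (ii) The hyperbolic rotational surface of the first kind $\mathbf{M}_{-1}$: $$\mathbf{r}_{-1}(\lambda,v)=\left(x(\lambda),\,y(\lambda),\,w(\lambda)\sinh v,\,w(\lambda)\cosh v\right),\quad \lambda\in J\subset\mathbb{R},\ v\in\mathbb{R},$$ $$x(\lambda)=\sqrt{1+w^2(\lambda)}\cos\phi(\lambda),\quad y(\lambda)=\sqrt{1+w^2(\lambda)}\sin\phi(\lambda)\quad\text{for }w(\lambda)>0,$$ where $$w(\lambda)=c\,e^{\int\frac{d\lambda}{\varepsilon f(\lambda)-\lambda}},\qquad \phi(\lambda)=\phi_0\pm\int\frac{\lambda w^2(\lambda)\,d\lambda}{(1+w^2(\lambda))(\varepsilon f(\lambda)-\lambda)\sqrt{(\lambda^2-\varepsilon)w^2(\lambda)-\varepsilon}}$$ with constants $c>0$ and $\phi_0$, $\varepsilon=\pm1$, and $(\lambda^2-\varepsilon)w^2(\lambda)-\varepsilon>0$ on an open interval $\tilde J\subset J$. When $\varepsilon=1$ the surface is spacelike; when $\varepsilon=-1$ it is timelike. (iii) The hyperbolic rotational surface of the second kind: $$\mathbf{r}(\lambda,v)=\left(x(\lambda),\,y(\lambda),\,w(\lambda)\cosh v,\,w(\lambda)\sinh v\right),\quad \lambda\in J\subset\mathbb{R},\ v\in\mathbb{R},$$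 $$x(\lambda)=\sqrt{1-w^2(\lambda)}\cos\phi(\lambda),\quad y(\lambda)=\sqrt{1-w^2(\lambda)}\sin\phi(\lambda)\quad\text{for }0<w(\lambda)<1,$$ where $$w(\lambda)=c\,e^{-\int\frac{d\lambda}{f(\lambda)+\lambda}},\qquad \phi(\lambda)=\phi_0\pm\int\frac{\lambda w^2(\lambda)\,d\lambda}{(1-w^2(\lambda))(f(\lambda)+\lambda)\sqrt{1-(\lambda^2+1)w^2(\lambda)}}$$ with constants $c>0$ and $\phi_0$, and $1-(\lambda^2+1)w^2(\lambda)>0$ on an open interval $\tilde J\subset J$. In this case the surface is timelike. (iv) The parabolic rotational surface $\mathbf{M}_0$: $$\mathbf{r}_0(\lambda,v)=\left(x(\lambda),\,v z(\lambda),\,z(\lambda),\,-\tfrac12 v^2z(\lambda)+w(\lambda)\right),\quad \lambda\in J\subset\mathbb{R},\ v\in\mathbb{R},$$ $$x(\lambda)=\phi(\lambda)z(\lambda),\quad w(\lambda)=\frac{1-x^2(\lambda)}{2z(\lambda)}\quad\text{for }z(\lambda)>0,$$ where $$z(\lambda)=c\,e^{\int\frac{d\lambda}{\varepsilon f(\lambda)-\lambda}},\qquad \phi(\lambda)=\phi_0\pm\int\frac{\lambda\,d\lambda}{z(\lambda)(\varepsilon f(\lambda)-\lambda)\sqrt{\lambda^2-\varepsilon}}$$ with constants $c>0$ and $\phi_0$, $\varepsilon=\pm1$, and $\lambda^2-\varepsilon>0$ on an open interval $\tilde J\subset J$. When $\varepsilon=1$ the surface is spacelike; when $\varepsilon=-1$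 it is timelike.
   Context: $\mathbb{E}^4_1$ is 4-dimensional Minkowski space with metric $\tilde g$, and $\mathbb{S}^3_1=\{\mathbf{x}\in\mathbb{E}^4_1:\tilde g(\mathbf{x},\mathbf{x})=1\}$ is de Sitter space. For spherical and hyperbolic surfaces coordinates are used in which $\tilde g(\mathbf{x},\mathbf{y})=x_1y_1+x_2y_2+x_3y_3-x_4y_4$; for parabolic surfaces, coordinates in which $\tilde g(\mathbf{x},\mathbf{y})=x_1y_1+x_2y_2+x_3y_4+x_4y_3$. The rotational surfaces in $\mathbb{S}^3_1$ are parameterized as follows, where $u\in J$ (an open interval of $\mathbb{R}$) is the arc length parameter of the profile curve $C$, $\tilde g(C',C')=\varepsilon=\pm1$, and $'=d/du$. - Spherical, $\mathbf{M}_1$: $r(u,v)=(y(u)\sin v,y(u)\cos v,z(u),w(u))$, $v\in[0,2\pi]$, $y>0$, $y^2+z^2-w^2=1$, $y'^2+z'^2-w'^2=\varepsilon$; induced metric $\varepsilon du^2+y^2dv^2$; $z',w'$ nonzero. - Hyperbolic of the first kind, $\mathbf{M}_{-1}$: $r(u,v)=(x(u),y(u),w(u)\sinh v,w(u)\cosh v)$, $v\in\mathbb{R}$, $w>0$, $x^2+y^2-w^2=1$, $x'^2+y'^2-w'^2=\varepsilon$; induced metric $\varepsilon du^2+w^2dv^2$; $x',y'$ nonzero. - Hyperbolic of the second kind: $r(u,v)=(x(u),y(u),w(u)\cosh v,w(u)\sinh v)$, $v\in\mathbb{R}$, $w>0$, $x^2+y^2+w^2=1$, $x'^2+y'^2+w'^2=1$;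 induced metric $du^2-w^2dv^2$ (timelike); $x',y'$ nonzero. - Parabolic, $\mathbf{M}_0$: $r(u,v)=(x(u),v z(u),z(u),-\tfrac12v^2z(u)+w(u))$, $v\in\mathbb{R}$, $z>0$, $2zw+x^2=1$, $2z'w'+x'^2=\varepsilon$; induced metric $\varepsilon du^2+z^2dv^2$; $x',z'$ nonzero. The surfaces are assumed not contained in a hyperplane of $\mathbb{E}^4_1$ (this is the reason for the nonvanishing conditions above). The surfaces $\mathbf{M}_\delta$ are spacelike if $\varepsilon=1$ and timelike if $\varepsilon=-1$. Principal curvatures: with $N$ a unit normal field of the surface in $\mathbb{S}^3_1$, $\kappa=\tilde g(r_{uu},N)$ and $\lambda=\tilde g(r_{vv},N)/|\tilde g(r_v,r_v)|$, so $\kappa$ corresponds to the profile curve direction and $\lambda$ to the rotation direction. The eigenvalues of the shape operator are $\varepsilon\kappa,\lambda$ for $\mathbf{M}_\delta$ and $\kappa,-\lambda$ for the hyperbolic surface of the second kind. A point is umbilical if the shape operator is a multiple of the identity there, i.e. $\varepsilon\kappa=\lambda$ (resp. $\kappa=-\lambda$).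
   Formalization: In (i) the pair (z,w) is allowed an overall sign ±1, since surfaces with z<0 (y<1) or w<0 (y>1) also meet the hypotheses; formulas hold on open intervals where λ'≠0, equivalently where the stated quantity is positive. *)

(* Defs.v *)
From Stdlib Require Import Reals.
From Coquelicot Require Import Coquelicot.
Open Scope R_scope.

Record vec4 := Vec4 { x1 : R; x2 : R; x3 : R; x4 : R }.

Inductive rot_type := Spherical | Hyperbolic1 | Hyperbolic2 | Parabolic.

(* The Minkowski metric; for parabolic surfaces the coordinates are taken with
   respect to a basis whose last two vectors are null. *)
Definition g (k : rot_type) (a b : vec4) : R :=
  match k with
  | Parabolic => x1 a * x1 b + x2 a * x2 b + x3 a * x4 b + x4 a * x3 b
  | _ => x1 a * x1 b + x2 a * x2 b + x3 a * x3 b - x4 a * x4 b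
  end.

Definition open_itv (a b : Rbar) (u : R) : Prop := Rbar_lt a u /\ Rbar_lt u b.

(* Range of the rotation parameter v. *)
Definition rot_range (k : rot_type) (v : R) : Prop :=
  match k with Spherical => 0 <= v <= 2 * PI | _ => True end.

(* The rotational surface with profile functions (p, q, s), which are
     (y, z, w)  for Spherical,
     (x, y, w)  for Hyperbolic1 and Hyperbolic2,
     (x, z, w)  for Parabolic. *)
Definition rot (k : rot_type) (p q s : R -> R) (u v : R) : vec4 :=
  match k with
  | Spherical => Vec4 (p u * sin v) (p u * cos v) (q u) (s u)
  | Hyperbolic1 => Vec4 (p u) (q u) (s u * sinh v) (s u * cosh v)
  | Hyperbolic2 => Vec4 (p u) (q u) (s u * cosh v) (s u * sinh v)
  | Parabolic => Vec4 (p u) (v * q u) (q u) (- (1 / 2) * v ^ 2 * q u + s u)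
  end.

Definition C2_on (J : R -> Prop) (h : R -> R) : Prop :=
  forall u, J u ->
    ex_derive h u /\ ex_derive (Derive h) u /\ continuous (Derive (Derive h)) u.

(* Positivity of the radius, profile curve in de Sitter space, arc length
   parameterization, and the nonvanishing conditions. *)
Definition profile_conditions (k : rot_type) (eps : R) (p q s : R -> R) (u : R)
  : Prop :=
  match k with
  | Spherical =>
      0 < p u /\ p u ^ 2 + q u ^ 2 - s u ^ 2 = 1 /\
      Derive p u ^ 2 + Derive q u ^ 2 - Derive s u ^ 2 = eps /\
      Derive q u <> 0 /\ Derive s u <> 0
  | Hyperbolic1 =>
      0 < s u /\ p u ^ 2 + q u ^ 2 - s u ^ 2 = 1 /\
      Derive p u ^ 2 + Derive q u ^ 2 - Derive s u ^ 2 = eps /\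
      Derive p u <> 0 /\ Derive q u <> 0
  | Hyperbolic2 =>
      0 < s u /\ p u ^ 2 + q u ^ 2 + s u ^ 2 = 1 /\
      (Derive p u ^ 2 + Derive q u ^ 2 + Derive s u ^ 2 = 1 /\ eps = 1) /\
      Derive p u <> 0 /\ Derive q u <> 0
  | Parabolic =>
      0 < q u /\ 2 * q u * s u + p u ^ 2 = 1 /\
      2 * Derive q u * Derive s u + Derive p u ^ 2 = eps /\
      Derive p u <> 0 /\ Derive q u <> 0
  end.

Definition in_hyperplane (k : rot_type) (J V : R -> Prop) (X : R -> R -> vec4)
  : Prop :=
  exists (A : vec4) (d : R), A <> Vec4 0 0 0 0 /\
    forall u v, J u -> V v -> g k A (X u v) = d.

Definition rotational_surface (k : rot_type) (eps : R) (a b : Rbar)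
    (p q s : R -> R) : Prop :=
  Rbar_lt a b /\ (eps = 1 \/ eps = -1) /\
  C2_on (open_itv a b) p /\ C2_on (open_itv a b) q /\ C2_on (open_itv a b) s /\
  (forall u, open_itv a b u -> profile_conditions k eps p q s u) /\
  ~ in_hyperplane k (open_itv a b) (rot_range k) (rot k p q s).

Definition du (X : R -> R -> vec4) (u v : R) : vec4 :=
  Vec4 (Derive (fun t => x1 (X t v)) u) (Derive (fun t => x2 (X t v)) u)
       (Derive (fun t => x3 (X t v)) u) (Derive (fun t => x4 (X t v)) u).

Definition dv (X : R -> R -> vec4) (u v : R) : vec4 :=
  Vec4 (Derive (fun t => x1 (X u t)) v) (Derive (fun t => x2 (X u t)) v)
       (Derive (fun t => x3 (X u t)) v) (Derive (fun t => x4 (X u t)) v).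

Definition spacelike_at (k : rot_type) (X : R -> R -> vec4) (u v : R) : Prop :=
  0 < g k (du X u v) (du X u v) /\
  0 < g k (du X u v) (du X u v) * g k (dv X u v) (dv X u v)
      - g k (du X u v) (dv X u v) ^ 2.

Definition timelike_at (k : rot_type) (X : R -> R -> vec4) (u v : R) : Prop :=
  g k (du X u v) (du X u v) * g k (dv X u v) (dv X u v)
  - g k (du X u v) (dv X u v) ^ 2 < 0.

(* N is tangent to de Sitter space (orthogonal to the position vector), and
   unit means g(N,N) = 1 or -1, the sign depending on the causal character. *)
Definition unit_normal_field (k : rot_type) (J V : R -> Prop)
    (X N : R -> R -> vec4) : Prop :=
  (forall u v, J u -> V v ->
     g k (N u v) (X u v) = 0 /\ g k (N u v) (du X u v) = 0 /\
     g k (N u v) (dv X u v) = 0 /\ Rabs (g k (N u v) (N u v)) = 1) /\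
  let D := fun z : R * R => J (fst z) /\ V (snd z) in
  continuous_on D (fun z => x1 (N (fst z) (snd z))) /\
  continuous_on D (fun z => x2 (N (fst z) (snd z))) /\
  continuous_on D (fun z => x3 (N (fst z) (snd z))) /\
  continuous_on D (fun z => x4 (N (fst z) (snd z))).

Definition kappa (k : rot_type) (X N : R -> R -> vec4) (u v : R) : R :=
  g k (du (du X) u v) (N u v).

Definition lambda (k : rot_type) (X N : R -> R -> vec4) (u v : R) : R :=
  g k (dv (dv X) u v) (N u v) / Rabs (g k (dv X u v) (dv X u v)).

(* The shape operator A satisfies g(A Y, Z) = II(Y, Z) for tangent Y, Z, and the
   first fundamental form is nondegenerate; hence A = rho * Id means II = rho I. *)
Definition umbilical_at (k : rot_type) (X N : R -> R -> vec4) (u v : R) : Prop :=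
  exists rho : R,
    g k (du (du X) u v) (N u v) = rho * g k (du X u v) (du X u v) /\
    g k (du (dv X) u v) (N u v) = rho * g k (du X u v) (dv X u v) /\
    g k (dv (dv X) u v) (N u v) = rho * g k (dv X u v) (dv X u v).

(* The quantity required to be positive; l is the value of lambda and rho the
   radius of the rotation at that point. *)
Definition positivity_term (k : rot_type) (eps l rho : R) : R :=
  match k with
  | Spherical => (l ^ 2 - eps) * rho ^ 2 + eps
  | Hyperbolic1 => (l ^ 2 - eps) * rho ^ 2 - eps
  | Hyperbolic2 => 1 - (l ^ 2 + 1) * rho ^ 2
  | Parabolic => l ^ 2 - eps
  end.

Definition radius (k : rot_type) (p q s : R -> R) : R -> R :=
  match k with Spherical => p | Parabolic => q | _ => s end.

Definition antiderivative (I : R -> Prop) (h H : R -> R) : Prop :=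
  forall t, I t -> is_derive H t (h t).

(* phi = phi0 +- (an antiderivative of h). *)
Definition pm_integral (I : R -> Prop) (h phi : R -> R) : Prop :=
  exists (phi0 sg : R) (Phi : R -> R), (sg = 1 \/ sg = -1) /\
    antiderivative I h Phi /\ forall t, I t -> phi t = phi0 + sg * Phi t.

(* rho = c exp (an antiderivative of h). *)
Definition exp_integral (I : R -> Prop) (h rho : R -> R) : Prop :=
  exists (c : R) (H : R -> R), 0 < c /\
    antiderivative I h H /\ forall t, I t -> rho t = c * exp (H t).

(* sigma accounts for the isometry (x1,x2,x3,x4) |-> (x1,x2,-x3,-x4), which maps
   spherical rotational surfaces to such: it is needed because z < 0 (if y < 1)
   or w < 0 (if y > 1) is possible. *)
Definition spherical_profile (eps : R) (f : R -> R) (I : R -> Prop)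
    (y z w : R -> R) : Prop :=
  let angle := pm_integral I (fun t => t * y t ^ 2 /
     ((y t ^ 2 - 1) * (eps * f t - t) * sqrt ((t ^ 2 - eps) * y t ^ 2 + eps))) in
  exp_integral I (fun t => 1 / (eps * f t - t)) y /\
  (forall t, I t -> 0 < (t ^ 2 - eps) * y t ^ 2 + eps) /\
  ((forall t, I t -> 0 < y t < 1) ->
     exists (phi : R -> R) (sigma : R), (sigma = 1 \/ sigma = -1) /\ angle phi /\
     forall t, I t ->
       z t = sigma * (sqrt (1 - y t ^ 2) * cosh (phi t)) /\
       w t = sigma * (sqrt (1 - y t ^ 2) * sinh (phi t))) /\
  ((forall t, I t -> 1 < y t) ->
     exists (phi : R -> R) (sigma : R), (sigma = 1 \/ sigma = -1) /\ angle phi /\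
     forall t, I t ->
       z t = sigma * (sqrt (y t ^ 2 - 1) * sinh (phi t)) /\
       w t = sigma * (sqrt (y t ^ 2 - 1) * cosh (phi t))).

Definition hyperbolic1_profile (eps : R) (f : R -> R) (I : R -> Prop)
    (x y w : R -> R) : Prop :=
  exp_integral I (fun t => 1 / (eps * f t - t)) w /\
  (forall t, I t -> 0 < (t ^ 2 - eps) * w t ^ 2 - eps) /\
  (forall t, I t -> 0 < w t) /\
  exists phi : R -> R,
    pm_integral I (fun t => t * w t ^ 2 /
      ((1 + w t ^ 2) * (eps * f t - t) * sqrt ((t ^ 2 - eps) * w t ^ 2 - eps)))
      phi /\
    forall t, I t ->
      x t = sqrt (1 + w t ^ 2) * cos (phi t) /\
      y t = sqrt (1 + w t ^ 2) * sin (phi t).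

Definition hyperbolic2_profile (f : R -> R) (I : R -> Prop)
    (x y w : R -> R) : Prop :=
  exp_integral I (fun t => - (1 / (f t + t))) w /\
  (forall t, I t -> 0 < 1 - (t ^ 2 + 1) * w t ^ 2) /\
  (forall t, I t -> 0 < w t < 1) /\
  exists phi : R -> R,
    pm_integral I (fun t => t * w t ^ 2 /
      ((1 - w t ^ 2) * (f t + t) * sqrt (1 - (t ^ 2 + 1) * w t ^ 2))) phi /\
    forall t, I t ->
      x t = sqrt (1 - w t ^ 2) * cos (phi t) /\
      y t = sqrt (1 - w t ^ 2) * sin (phi t).

Definition parabolic_profile (eps : R) (f : R -> R) (I : R -> Prop)
    (x z w : R -> R) : Prop :=
  exp_integral I (fun t => 1 / (eps * f t - t)) z /\
  (forall t, I t -> 0 < t ^ 2 - eps) /\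
  (forall t, I t -> 0 < z t) /\
  exists phi : R -> R,
    pm_integral I (fun t => t / (z t * (eps * f t - t) * sqrt (t ^ 2 - eps))) phi /\
    forall t, I t ->
      x t = phi t * z t /\ w t = (1 - x t ^ 2) / (2 * z t).

Definition lambda_profile (k : rot_type) (eps : R) (f : R -> R) (I : R -> Prop)
    (p q s : R -> R) : Prop :=
  match k with
  | Spherical => spherical_profile eps f I p q s
  | Hyperbolic1 => hyperbolic1_profile eps f I p q s
  | Hyperbolic2 => hyperbolic2_profile f I p q s
  | Parabolic => parabolic_profile eps f I p q s
  end.

Definition causal_character (k : rot_type) (eps : R) (X : R -> R -> vec4)
    (u v : R) : Prop :=
  match k with
  | Hyperbolic2 => timelike_at k X u v
  | _ => (eps = 1 -> spacelike_at k X u v) /\ (eps = -1 -> timelike_at k X u v)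
  end.

(* mu is the inverse of the change of parameter lam : J -> ]al, be[; both are
   differentiable. *)
Definition change_of_parameter (J : R -> Prop) (lam : R -> R) (al be : Rbar)
    (mu : R -> R) : Prop :=
  (forall u, J u -> open_itv al be (lam u) /\ mu (lam u) = u /\ ex_derive lam u) /\
  (forall t, open_itv al be t -> J (mu t) /\ lam (mu t) = t /\ ex_derive mu t).

(* Main.v *)
Require Import Defs.
From Stdlib Require Import Reals Lra Classical ClassicalEpsilon Ranalysis5.
From Coquelicot Require Import Coquelicot.
Open Scope R_scope.
Set Bullet Behavior "Strict Subproofs".

(* Each of the four families is the image of a curve r in a 3-dimensional
   quadratic space under a one-parameter group of isometries, so everything
   reduces to the frame (r, r', n), where n is the cross product of r and r'.
   By connectedness the given unit normal is +n or -n throughout. With rho the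
   radius, e the (suitably normalized) acceleration vector of the rotation,
   W = det (r, r', e) and d = 1 for the second hyperbolic family, d = -1 for
   the others, lambda = +-W / rho. Gram determinants give the Codazzi equation
     lambda' = (- d eps kappa - lambda) rho' / rho
   and the formula rho'^2 = positivity_term (times rho^2 in the parabolic case).
   The factor - d eps f(lambda) - lambda vanishes only at umbilical points, so
   lambda' = 0 iff rho' = 0, and where lambda' <> 0 one can take lambda as
   parameter: (ln rho)' is then the inverse of that factor, and the derivative
   of the polar (hyperbolic, parabolic) angle of the other two profile
   functions is, up to sign, W divided by the square of the polar radius. *)

(** * The profile space *)

Record vec3 := Vec3 { y1 : R; y2 : R; y3 : R }.

Definition smul3 (c : R) (a : vec3) : vec3 := Vec3 (c * y1 a) (c * y2 a) (c * y3 a).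

Definition curve (p q s : R -> R) (u : R) : vec3 := Vec3 (p u) (q u) (s u).

Definition form (k : rot_type) (a b : vec3) : R :=
  match k with
  | Hyperbolic2 => y1 a * y1 b + y2 a * y2 b + y3 a * y3 b
  | Parabolic => y1 a * y1 b + y2 a * y3 b + y3 a * y2 b
  | _ => y1 a * y1 b + y2 a * y2 b - y3 a * y3 b
  end.

(** Determinant of the matrix of [form k] in the standard basis. It is 1 or -1, hence its own
    inverse, which is how it is moved across equations below. *)
Definition form_disc (k : rot_type) : R :=
  match k with Hyperbolic2 => 1 | _ => -1 end.

Definition det3 (a b c : vec3) : R :=
  (y2 a * y3 b - y3 a * y2 b) * y1 c + (y3 a * y1 b - y1 a * y3 b) * y2 c
  + (y1 a * y2 b - y2 a * y1 b) * y3 c.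

(* The cross product relative to [form k]: see [form_normal]. *)
Definition normal (k : rot_type) (a b : vec3) : vec3 :=
  let c1 := y2 a * y3 b - y3 a * y2 b in
  let c2 := y3 a * y1 b - y1 a * y3 b in
  let c3 := y1 a * y2 b - y2 a * y1 b in
  match k with
  | Hyperbolic2 => Vec3 c1 c2 c3
  | Parabolic => Vec3 c1 c3 c2
  | _ => Vec3 c1 c2 (- c3)
  end.

Lemma form_sym (k : rot_type) (a b : vec3) : form k a b = form k b a.
Proof. destruct k; simpl; ring. Qed.

Lemma form_smul (k : rot_type) (c : R) (a b : vec3) :
  form k a (smul3 c b) = c * form k a b.
Proof. destruct k; simpl; ring. Qed.

Lemma form_normal (k : rot_type) (a b c : vec3) :
  form k (normal k a b) c = det3 a b c.
Proof. destruct k; unfold det3; simpl; ring. Qed.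

(** With G the matrix of the form and A, B the matrices with rows a, b, c and a', b', c', both sides
    are the determinant of A G B^T; the right-hand side is its expansion along the first row. *)
Lemma gram (k : rot_type) (a b c a' b' c' : vec3) :
  form_disc k * det3 a b c * det3 a' b' c' =
  form k a a' * (form k b b' * form k c c' - form k b c' * form k c b')
  - form k a b' * (form k b a' * form k c c' - form k b c' * form k c a')
  + form k a c' * (form k b a' * form k c b' - form k b b' * form k c a').
Proof. destruct k; unfold det3; simpl; ring. Qed.

Lemma form_disc_sqr (k : rot_type) : form_disc k * form_disc k = 1.
Proof. destruct k; simpl; ring. Qed.

Lemma normal_norm (k : rot_type) (a b : vec3) :
  form k (normal k a b) (normal k a b) =
  form_disc k * (form k a a * form k b b - form k a b ^ 2).
Proof. destruct k; simpl; ring. Qed.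

(** When the normal n is not null, a, b and n form a basis, and a vector orthogonal to a and b has
    no component along them. *)
Lemma orthogonal_to_plane (k : rot_type) (a b m : vec3) :
  form k m a = 0 -> form k m b = 0 ->
  form k (normal k a b) (normal k a b) <> 0 ->
  m = smul3 (form k m (normal k a b) / form k (normal k a b) (normal k a b))
        (normal k a b).
Proof.
intros ha hb hn.
(* Cramer's rule in the basis a, b, n with denominators cleared, so that each coordinate is a
   polynomial identity; [y] runs over the coordinate functions. *)
assert (E : forall y : vec3 -> R, (y = y1 \/ y = y2 \/ y = y3) ->
  form k (normal k a b) (normal k a b) * y m =
  form_disc k * (form k m a * form k b b - form k m b * form k a b) * y a +
  form_disc k * (form k m b * form k a a - form k m a * form k a b) * y b +
  form k m (normal k a b) * y (normal k a b)).
{ intros y [-> | [-> | ->]]; destruct k; simpl; ring. }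
rewrite ha, hb in E.
set (n := normal k a b) in *.
assert (F : forall y : vec3 -> R, (y = y1 \/ y = y2 \/ y = y3) ->
  y m = form k m n / form k n n * y n).
{ intros y hy; apply (Rmult_eq_reg_l (form k n n)); [|exact hn].
  rewrite (E y hy); field; exact hn. }
destruct m as [m1 m2 m3]; unfold smul3.
f_equal; [apply (F y1)|apply (F y2)|apply (F y3)]; auto.
Qed.

(* Rotation by [v] of a point of the profile space. *)
Definition emb (k : rot_type) (v : R) (a : vec3) : vec4 :=
  rot k (fun _ => y1 a) (fun _ => y2 a) (fun _ => y3 a) 0 v.

(* The velocity of the rotation at unit radius; its derivative in [v] is
   [emb k v (axis k)]. *)
Definition tang (k : rot_type) (v : R) : vec4 :=
  match k with
  | Spherical => Vec4 (cos v) (- sin v) 0 0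
  | Hyperbolic1 => Vec4 0 0 (cosh v) (sinh v)
  | Hyperbolic2 => Vec4 0 0 (sinh v) (cosh v)
  | Parabolic => Vec4 0 1 0 (- v)
  end.

(** Pairing with this vector reads off the radius, see [form_axis]. It is null in the parabolic
    case, which is why the radius drops out of [positivity_term] there. *)
Definition axis (k : rot_type) : vec3 :=
  match k with
  | Spherical => Vec3 (-1) 0 0
  | Parabolic => Vec3 0 0 (-1)
  | _ => Vec3 0 0 1
  end.

Definition smul4 (c : R) (a : vec4) : vec4 :=
  Vec4 (c * x1 a) (c * x2 a) (c * x3 a) (c * x4 a).

Definition add4 (a b : vec4) : vec4 :=
  Vec4 (x1 a + x1 b) (x2 a + x2 b) (x3 a + x3 b) (x4 a + x4 b).

Lemma sin_sqr (v : R) : sin v * sin v = 1 - cos v * cos v.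
Proof. generalize (sin2_cos2 v); unfold Rsqr; lra. Qed.

Lemma cosh_sqr (v : R) : cosh v * cosh v = 1 + sinh v * sinh v.
Proof.
unfold cosh, sinh; assert (E : exp v * exp (- v) = 1) by
  (rewrite <- exp_plus, Rplus_opp_r; apply exp_0).
nra.
Qed.

Lemma g_emb (k : rot_type) (v : R) (a b : vec3) :
  g k (emb k v a) (emb k v b) = form k a b.
Proof.
generalize (sin_sqr v) (cosh_sqr v); intros hs hc.
destruct k; simpl; try field.
- transitivity (y1 a * y1 b * (sin v * sin v + cos v * cos v) + y2 a * y2 b - y3 a * y3 b);
    [ring|rewrite hs; ring].
- transitivity (y1 a * y1 b + y2 a * y2 b - y3 a * y3 b * (cosh v * cosh v - sinh v * sinh v));
    [ring|rewrite hc; ring].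
- transitivity (y1 a * y1 b + y2 a * y2 b + y3 a * y3 b * (cosh v * cosh v - sinh v * sinh v));
    [ring|rewrite hc; ring].
Qed.

Lemma g_sym (k : rot_type) (a b : vec4) : g k a b = g k b a.
Proof. destruct k; simpl; ring. Qed.

Lemma g_smul (k : rot_type) (c : R) (a b : vec4) : g k (smul4 c a) b = c * g k a b.
Proof. destruct k; simpl; ring. Qed.

Lemma g_emb_tang (k : rot_type) (v : R) (a : vec3) : g k (emb k v a) (tang k v) = 0.
Proof. destruct k; simpl; ring. Qed.

Lemma g_tang (k : rot_type) (v : R) : g k (tang k v) (tang k v) = - form_disc k.
Proof.
generalize (sin_sqr v) (cosh_sqr v); intros hs hc; destruct k; simpl; lra.
Qed.

(** The image of [emb k v] is the orthogonal complement of [tang k v]; these are the profile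
    coordinates of the orthogonal projection onto it. *)
Definition unemb (k : rot_type) (v : R) (a : vec4) : vec3 :=
  match k with
  | Spherical => Vec3 (x1 a * sin v + x2 a * cos v) (x3 a) (x4 a)
  | Hyperbolic1 => Vec3 (x1 a) (x2 a) (x4 a * cosh v - x3 a * sinh v)
  | Hyperbolic2 => Vec3 (x1 a) (x2 a) (x3 a * cosh v - x4 a * sinh v)
  | Parabolic => Vec3 (x1 a) (x3 a) (x4 a + v * x2 a - 1 / 2 * v ^ 2 * x3 a)
  end.

Lemma emb_unemb (k : rot_type) (v : R) (a : vec4) :
  g k a (tang k v) = 0 -> emb k v (unemb k v a) = a.
Proof.
generalize (sin_sqr v) (cosh_sqr v); intros hs hc h.
(* Orthogonal decomposition along [tang k v], whose norm [- form_disc k] is its own inverse and so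
   appears as the coefficient. *)
assert (E : a = add4 (emb k v (unemb k v a))
                     (smul4 (- form_disc k * g k a (tang k v)) (tang k v))).
{ destruct a as [a1 a2 a3 a4]; unfold add4, smul4;
  destruct k; simpl; f_equal; try ring.
  - transitivity (a1 * (sin v * sin v + cos v * cos v)); [rewrite hs|]; ring.
  - transitivity (a2 * (sin v * sin v + cos v * cos v)); [rewrite hs|]; ring.
  - transitivity (a3 * (cosh v * cosh v - sinh v * sinh v)); [rewrite hc|]; ring.
  - transitivity (a4 * (cosh v * cosh v - sinh v * sinh v)); [rewrite hc|]; ring.
  - transitivity (a3 * (cosh v * cosh v - sinh v * sinh v)); [rewrite hc|]; ring.
  - transitivity (a4 * (cosh v * cosh v - sinh v * sinh v)); [rewrite hc|]; ring.
  - field. }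
rewrite h in E; rewrite E at 2.
set (b := emb k v (unemb k v a)); destruct b as [b1 b2 b3 b4].
unfold add4, smul4; simpl; f_equal; ring.
Qed.

Lemma rot_emb (k : rot_type) (p q s : R -> R) (u v : R) :
  rot k p q s u v = emb k v (curve p q s u).
Proof. destruct k; reflexivity. Qed.

Lemma form_axis (k : rot_type) (p q s : R -> R) (u : R) :
  form k (curve p q s u) (axis k) = form_disc k * radius k p q s u.
Proof. destruct k; simpl; ring. Qed.

(** * Derivatives along the profile curve *)

(** Contracts the eta-expanded functions under [Derive] left by [auto_derive], so that [ring] and
    [field] identify these terms. *)
Ltac eta_derive :=
  repeat match goal with
  | |- context [Derive (fun x => ?h x) ?u] =>
      progress change (Derive (fun x => h x) u) with (Derive h u)
  end.

Lemma is_derive_sinh (v : R) : is_derive sinh v (cosh v).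
Proof. apply is_derive_Reals, derivable_pt_lim_sinh. Qed.

Lemma is_derive_cosh (v : R) : is_derive cosh v (sinh v).
Proof. apply is_derive_Reals, derivable_pt_lim_cosh. Qed.

Lemma du_ext_loc (X Y : R -> R -> vec4) (u v : R) :
  locally u (fun t => X t v = Y t v) -> du X u v = du Y u v.
Proof.
intros h; unfold du; f_equal; apply Derive_ext_loc;
  revert h; apply filter_imp; intros t ->; reflexivity.
Qed.

Lemma dv_ext (X Y : R -> R -> vec4) (u v : R) :
  (forall t, X u t = Y u t) -> dv X u v = dv Y u v.
Proof.
intros h; unfold dv; f_equal; apply Derive_ext; intros t; now rewrite h.
Qed.

Lemma du_rot (k : rot_type) (p q s : R -> R) (u v : R) :
  ex_derive p u -> ex_derive q u -> ex_derive s u ->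
  du (rot k p q s) u v = emb k v (curve (Derive p) (Derive q) (Derive s) u).
Proof.
intros hp hq hs.
destruct k; unfold du; simpl; f_equal; apply is_derive_unique; auto_derive;
  auto; eta_derive; ring.
Qed.

Lemma dv_rot (k : rot_type) (p q s : R -> R) (u v : R) :
  dv (rot k p q s) u v = smul4 (radius k p q s u) (tang k v).
Proof.
destruct k; unfold dv, smul4; simpl; f_equal; apply is_derive_unique;
  try (auto_derive; auto; field);
  try (apply (is_derive_scal sinh), is_derive_sinh);
  try (apply (is_derive_scal cosh), is_derive_cosh).
Qed.

Lemma dv_tang (k : rot_type) (rho : R -> R) (u v : R) :
  dv (fun u v => smul4 (rho u) (tang k v)) u v = emb k v (smul3 (rho u) (axis k)).
Proof.
destruct k; unfold dv, smul4, smul3; simpl; f_equal; apply is_derive_unique;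
  try (auto_derive; auto; field).
all: rewrite Rmult_1_r;
  try (apply (is_derive_scal sinh), is_derive_sinh);
  try (apply (is_derive_scal cosh), is_derive_cosh).
Qed.

Lemma du_tang (k : rot_type) (rho : R -> R) (u v : R) :
  du (fun u v => smul4 (rho u) (tang k v)) u v = smul4 (Derive rho u) (tang k v).
Proof.
unfold du, smul4; simpl; f_equal; apply Derive_scal_l.
Qed.

Lemma is_derive_form (k : rot_type) (p q s p' q' s' : R -> R) (u : R) :
  ex_derive p u -> ex_derive q u -> ex_derive s u ->
  ex_derive p' u -> ex_derive q' u -> ex_derive s' u ->
  is_derive (fun t => form k (curve p q s t) (curve p' q' s' t)) u
    (form k (curve (Derive p) (Derive q) (Derive s) u) (curve p' q' s' u) +
     form k (curve p q s u) (curve (Derive p') (Derive q') (Derive s') u)).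
Proof.
intros; destruct k; simpl; auto_derive; repeat split; auto; eta_derive; ring.
Qed.

Lemma locally_open_itv (a b : Rbar) (u : R) :
  open_itv a b u -> locally u (open_itv a b).
Proof.
intros [h1 h2]; apply filter_and.
- apply (open_Rbar_gt a u h1).
- apply (open_Rbar_lt b u h2).
Qed.

Lemma form_const_derive (k : rot_type) (a b : Rbar) (c : R) (p q s p' q' s' : R -> R) (u : R) :
  ex_derive p u -> ex_derive q u -> ex_derive s u ->
  ex_derive p' u -> ex_derive q' u -> ex_derive s' u ->
  (forall t, open_itv a b t -> form k (curve p q s t) (curve p' q' s' t) = c) ->
  open_itv a b u ->
  form k (curve (Derive p) (Derive q) (Derive s) u) (curve p' q' s' u) +
  form k (curve p q s u) (curve (Derive p') (Derive q') (Derive s') u) = 0.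
Proof.
intros hp hq hs hp' hq' hs' hc hu.
rewrite <- (is_derive_unique _ _ _ (is_derive_form k _ _ _ _ _ _ _ hp hq hs hp' hq' hs')).
rewrite <- (Derive_const c u); apply Derive_ext_loc.
generalize (locally_open_itv _ _ _ hu); apply filter_imp, hc.
Qed.

Definition frame_relations (k : rot_type) (eps rho : R) (r r' r'' : vec3) : Prop :=
  0 < rho /\ form k r r = 1 /\ form k r r' = 0 /\ form k r' r' = eps /\
  form k r r'' = - eps /\ form k r' r'' = 0.

(** The profile conditions give (r, r) = 1 and (r', r') = eps; differentiating these, and then (r,
    r') = 0, gives the other products. *)
Lemma frame_of_surface (k : rot_type) (eps : R) (a b : Rbar) (p q s : R -> R) (u : R) :
  rotational_surface k eps a b p q s -> open_itv a b u ->
  frame_relations k eps (radius k p q s u) (curve p q s u)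
    (curve (Derive p) (Derive q) (Derive s) u)
    (curve (Derive (Derive p)) (Derive (Derive q)) (Derive (Derive s)) u).
Proof.
intros [_ [_ [hp [hq [hs [hc _]]]]]].
assert (h0 : forall u, open_itv a b u -> 0 < radius k p q s u /\
  form k (curve p q s u) (curve p q s u) = 1 /\
  form k (curve (Derive p) (Derive q) (Derive s) u)
    (curve (Derive p) (Derive q) (Derive s) u) = eps).
{ intros t ht; generalize (hc t ht); destruct k; simpl; intros [h1 [h2 [h3 _]]];
  repeat split; try lra. }
assert (h1 : forall u, open_itv a b u ->
  form k (curve p q s u) (curve (Derive p) (Derive q) (Derive s) u) = 0).
{ intros t ht; destruct (hp t ht) as [? _], (hq t ht) as [? _], (hs t ht) as [? _].
  assert (E := form_const_derive k a b 1 p q s p q s t).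
  rewrite form_sym in E; enough (forall x, x + x = 0 -> x = 0) as K
    by (apply K, E; auto; intros; apply h0; auto).
  intros; lra. }
intros hu; destruct (hp u hu) as [? [? _]], (hq u hu) as [? [? _]], (hs u hu) as [? [? _]].
destruct (h0 u hu) as [? [? E0]].
repeat split; auto.
- assert (E := form_const_derive k a b 0 p q s (Derive p) (Derive q) (Derive s) u).
  rewrite E0 in E; enough (forall x, eps + x = 0 -> x = - eps) as K by (apply K, E; auto).
  intros; lra.
- assert (E := form_const_derive k a b eps (Derive p) (Derive q) (Derive s)
                 (Derive p) (Derive q) (Derive s) u).
  rewrite form_sym in E; enough (forall x, x + x = 0 -> x = 0) as K
    by (apply K, E; auto; intros; apply h0; auto).
  intros; lra.
Qed.

Lemma rotational_eps (k : rot_type) (eps : R) (a b : Rbar) (p q s : R -> R) :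
  rotational_surface k eps a b p q s -> eps * eps = 1.
Proof. intros [_ [[-> | ->] _]]; ring. Qed.

Lemma rotational_nonempty (k : rot_type) (eps : R) (a b : Rbar) (p q s : R -> R) :
  rotational_surface k eps a b p q s -> exists u, open_itv a b u.
Proof.
intros [h _]; destruct a as [a| |], b as [b| |]; simpl in h; try easy.
- exists ((a + b) / 2); split; simpl; lra.
- exists (a + 1); split; simpl; lra.
- exists (b - 1); split; simpl; lra.
- exists 0; split; simpl; auto.
Qed.

(** * Sign constancy *)

(* Paths are precomposed with [clamp] so that they are defined on all of R, as
   the intermediate value theorem [IVT_cor] requires. *)
Definition clamp (t : R) : R := (Rabs t - Rabs (t - 1) + 1) / 2.

Lemma clamp_range (t : R) : 0 <= clamp t <= 1.
Proof. unfold clamp, Rabs; destruct (Rcase_abs t), (Rcase_abs (t - 1)); lra. Qed.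

Lemma clamp_0 : clamp 0 = 0.
Proof. unfold clamp; rewrite Rabs_R0, Rabs_left; lra. Qed.

Lemma clamp_1 : clamp 1 = 1.
Proof. unfold clamp; rewrite Rminus_diag, Rabs_R0, Rabs_R1; lra. Qed.

Definition seg (x y t : R) : R := x + clamp t * (y - x).

Lemma seg_0 (x y : R) : seg x y 0 = x.
Proof. unfold seg; rewrite clamp_0; ring. Qed.

Lemma seg_1 (x y : R) : seg x y 1 = y.
Proof. unfold seg; rewrite clamp_1; ring. Qed.

Lemma continuous_seg (x y t : R) : continuous (seg x y) t.
Proof.
apply continuity_pt_filterlim; unfold seg, clamp; reg.
Qed.

Lemma seg_open_itv (a b : Rbar) (x y t : R) :
  open_itv a b x -> open_itv a b y -> open_itv a b (seg x y t).
Proof.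
intros [h1 h2] [h3 h4]; generalize (clamp_range t); unfold seg; intros hc.
split; [destruct a|destruct b]; simpl in *; try easy;
  destruct (Rle_lt_dec x y); nra.
Qed.

Lemma seg_rot_range (k : rot_type) (x y t : R) :
  rot_range k x -> rot_range k y -> rot_range k (seg x y t).
Proof.
destruct k; simpl; auto; intros h1 h2; generalize (clamp_range t); unfold seg;
intros hc; nra.
Qed.

Lemma ivt_same_sign (h : R -> R) :
  (forall t, continuous h t) -> (forall t, h t <> 0) -> 0 < h 0 * h 1.
Proof.
intros hc hn; destruct (Rlt_le_dec 0 (h 0 * h 1)) as [|hle]; auto.
destruct (IVT_cor h 0 1) as [z [_ hz]]; auto; try lra.
- intros t; apply continuity_pt_filterlim, hc.
- now destruct (hn z).
Qed.

Lemma sign_const (a b : Rbar) (h : R -> R) :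
  (forall u, open_itv a b u -> continuous h u) ->
  (forall u, open_itv a b u -> h u <> 0) ->
  exists sg : R, (sg = 1 \/ sg = -1) /\ forall u, open_itv a b u -> 0 < sg * h u.
Proof.
intros hc hn.
assert (hs : forall x y, open_itv a b x -> open_itv a b y -> 0 < h x * h y).
{ intros x y hx hy; rewrite <- (seg_0 x y) at 1; rewrite <- (seg_1 x y) at 2.
  apply (ivt_same_sign (fun t => h (seg x y t))); intros t.
  - apply (continuous_comp (seg x y) h); [apply continuous_seg|].
    now apply hc, seg_open_itv.
  - now apply hn, seg_open_itv. }
destruct (classic (exists u, open_itv a b u)) as [[u0 h0]|hempty].
- destruct (Rdichotomy _ _ (hn u0 h0)) as [hlt|hgt]; [exists (-1)|exists 1];
    split; auto; intros u hu; generalize (hs u0 u h0 hu); nra.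
(* On an empty interval any sign will do. *)
- exists 1; split; auto; intros u hu; destruct hempty; eauto.
Qed.

(** The normal field is continuous only relative to its domain, which is closed in v for spherical
    surfaces. A path staying inside the domain turns this into ordinary continuity in one
    variable. *)
Lemma continuous_along (D : R * R -> Prop) (F : R * R -> R) (c d : R -> R) (t : R) :
  continuous_on D F -> (forall t, D (c t, d t)) ->
  continuous c t -> continuous d t -> continuous (fun t => F (c t, d t)) t.
Proof.
intros hF hD hc hd.
apply (filterlim_comp _ _ _ (fun t => (c t, d t)) F _ (within D (locally (c t, d t)))).
- intros P hP.
  assert (K : continuous (fun t => (c t, d t)) t).
  { apply (filterlim_comp_2 c d (fun x y => (x, y))
             (F := locally t) (G := locally (c t)) (H := locally (d t))); auto.
    intros Q [e he]; exists (fun x => ball (c t) e x) (fun y => ball (d t) e y).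
    - exists e; auto.
    - exists e; auto.
    - intros x y hx hy; apply he; split; auto. }
  exact (filter_imp _ _ (fun s hs => hs (hD s)) (K _ hP)).
- apply (hF (c t, d t)); auto.
Qed.

Lemma continuous_g (k : rot_type) (X Y : R -> vec4) (t : R) :
  (forall c, c = x1 \/ c = x2 \/ c = x3 \/ c = x4 ->
     continuous (fun t => c (X t)) t /\ continuous (fun t => c (Y t)) t) ->
  continuous (fun t => g k (X t) (Y t)) t.
Proof.
intros h.
destruct (h x1) as [? ?]; auto; destruct (h x2) as [? ?]; auto.
destruct (h x3) as [? ?]; auto; destruct (h x4) as [? ?]; auto.
destruct k; simpl; repeat
 first [apply @continuous_plus | apply @continuous_opp | apply @continuous_mult | assumption].
Qed.

Lemma continuous_curve_emb (k : rot_type) (p q s c d : R -> R) (t : R) :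
  continuous (fun t => p (c t)) t -> continuous (fun t => q (c t)) t ->
  continuous (fun t => s (c t)) t -> continuous d t ->
  forall x, x = x1 \/ x = x2 \/ x = x3 \/ x = x4 ->
  continuous (fun t => x (emb k (d t) (curve p q s (c t)))) t.
Proof.
intros hp hq hs hd x hx.
assert (h1 : continuous (fun t => sin (d t)) t)
  by (apply (continuous_comp d sin); auto; apply continuity_pt_filterlim; reg).
assert (h2 : continuous (fun t => cos (d t)) t)
  by (apply (continuous_comp d cos); auto; apply continuity_pt_filterlim; reg).
assert (h3 : continuous (fun t => sinh (d t)) t)
  by (apply (continuous_comp d sinh); auto; apply continuity_pt_filterlim; reg).
assert (h4 : continuous (fun t => cosh (d t)) t)
  by (apply (continuous_comp d cosh); auto; apply continuity_pt_filterlim; reg).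
assert (hc : forall r : R, continuous (fun _ : R => r) t)
  by (intros; apply continuous_const).
assert (h5 : continuous (fun t => - (1 / 2) * d t ^ 2) t).
{ simpl; repeat first [apply @continuous_mult | assumption | apply hc]. }
destruct hx as [-> | [-> | [-> | ->]]]; destruct k; simpl; auto;
  first [apply @continuous_mult | apply @continuous_plus]; auto;
  now apply @continuous_mult.
Qed.

(** * The unit normal *)

Lemma sqr_eq_1 (x : R) : x * x = 1 -> x = 1 \/ x = -1.
Proof.
intros h; assert (E : (x - 1) * (x + 1) = 0) by (ring_simplify; lra).
apply Rmult_integral in E; lra.
Qed.

Definition frame_normal (k : rot_type) (p q s : R -> R) (u : R) : vec3 :=
  normal k (curve p q s u) (curve (Derive p) (Derive q) (Derive s) u).

Lemma frame_normal_norm (k : rot_type) (eps : R) (a b : Rbar) (p q s : R -> R) (u : R) :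
  rotational_surface k eps a b p q s -> open_itv a b u ->
  form k (frame_normal k p q s u) (frame_normal k p q s u) = form_disc k * eps.
Proof.
intros hM hu; destruct (frame_of_surface _ _ _ _ _ _ _ u hM hu) as [_ [h1 [h2 [h3 _]]]].
unfold frame_normal; rewrite normal_norm, h1, h2, h3; ring.
Qed.

Lemma continuous_frame_normal (k : rot_type) (eps : R) (a b : Rbar) (p q s : R -> R) (u : R) :
  rotational_surface k eps a b p q s -> open_itv a b u ->
  forall y, y = y1 \/ y = y2 \/ y = y3 ->
  continuous (fun u => y (frame_normal k p q s u)) u.
Proof.
intros [_ [_ [hp [hq [hs _]]]]] hu y hy.
destruct (hp u hu) as [hp0 [hp1 _]], (hq u hu) as [hq0 [hq1 _]], (hs u hu) as [hs0 [hs1 _]].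
apply ex_derive_continuous in hp0, hp1, hq0, hq1, hs0, hs1.
destruct hy as [-> | [-> | ->]]; destruct k; simpl; unfold Rminus;
repeat first [assumption | apply @continuous_plus | apply @continuous_opp
  | apply @continuous_mult].
Qed.

(** Orthogonality to the rotation direction puts N in the image of [emb k v]; orthogonality to r and
    r' then makes it a multiple of the frame normal n. Since (n, n) = [form_disc k * eps] is its own
    inverse, [sg] is the coefficient, and the unit condition forces its square to be 1. *)
Lemma unit_normal_pointwise (k : rot_type) (eps : R) (a b : Rbar) (p q s : R -> R)
    (N : R -> R -> vec4) (u v : R) :
  rotational_surface k eps a b p q s ->
  unit_normal_field k (open_itv a b) (rot_range k) (rot k p q s) N ->
  open_itv a b u -> rot_range k v ->
  let sg := form_disc k * eps * g k (N u v) (emb k v (frame_normal k p q s u)) in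
  sg * sg = 1 /\ N u v = emb k v (smul3 sg (frame_normal k p q s u)).
Proof.
intros hM [hN _] hu hv sg.
destruct (hN u v hu hv) as [hr [hru [hrv hnn]]].
destruct (frame_of_surface _ _ _ _ _ _ _ u hM hu) as [hrho _].
assert (heps := rotational_eps _ _ _ _ _ _ _ hM).
assert (hd := form_disc_sqr k).
assert (hfn := frame_normal_norm _ _ _ _ _ _ _ u hM hu).
assert (hde : form_disc k * eps * (form_disc k * eps) = 1).
{ transitivity (form_disc k * form_disc k * (eps * eps)); [ring|rewrite hd, heps; ring]. }
assert (hne : form_disc k * eps <> 0) by (intros E; rewrite E in hde; lra).
assert (hinv : / (form_disc k * eps) = form_disc k * eps).
{ apply (Rmult_eq_reg_l (form_disc k * eps)); auto; now rewrite Rinv_r, hde. }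
rewrite dv_rot in hrv.
assert (ht : g k (N u v) (tang k v) = 0).
{ rewrite g_sym, g_smul, g_sym in hrv; apply Rmult_integral in hrv.
  destruct hrv; auto; lra. }
set (m := unemb k v (N u v)).
assert (hm : N u v = emb k v m) by (unfold m; now rewrite emb_unemb).
assert (hmsg : m = smul3 sg (frame_normal k p q s u)).
{ destruct hM as [_ [_ [hp [hq [hs _]]]]].
  destruct (hp u hu) as [? _], (hq u hu) as [? _], (hs u hu) as [? _].
  rewrite du_rot, hm, g_emb in hru; auto.
  rewrite rot_emb, hm, g_emb in hr.
  rewrite (orthogonal_to_plane _ _ _ _ hr hru).
  - fold (frame_normal k p q s u); rewrite hfn; unfold sg; rewrite hm, g_emb.
    unfold Rdiv; rewrite hinv; f_equal; ring.
  - fold (frame_normal k p q s u); now rewrite hfn. }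
rewrite hm, <- hmsg; split; auto.
rewrite hm, g_emb, hmsg, form_smul, form_sym, form_smul, hfn in hnn.
replace (sg * (sg * (form_disc k * eps))) with (sg * sg * (form_disc k * eps)) in hnn by ring.
rewrite Rabs_mult, (Rabs_pos_eq (sg * sg)) in hnn by nra.
enough (Rabs (form_disc k * eps) = 1) as E by (rewrite E in hnn; lra).
destruct (sqr_eq_1 _ hde) as [-> | ->]; [apply Rabs_R1|].
rewrite Rabs_left; lra.
Qed.

(** The coefficient of the pointwise statement never vanishes and is continuous along the segment
    from (u0, 0) to (u, v), so it has the same sign at both ends. *)
Lemma unit_normal_constant_sign (k : rot_type) (eps : R) (a b : Rbar) (p q s : R -> R)
    (N : R -> R -> vec4) :
  rotational_surface k eps a b p q s ->
  unit_normal_field k (open_itv a b) (rot_range k) (rot k p q s) N ->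
  exists sg : R, sg * sg = 1 /\ forall u v, open_itv a b u -> rot_range k v ->
    N u v = emb k v (smul3 sg (frame_normal k p q s u)).
Proof.
intros hM hN.
destruct (rotational_nonempty _ _ _ _ _ _ _ hM) as [u0 hu0].
assert (hv0 : rot_range k 0) by (destruct k; simpl; auto; generalize PI_RGT_0; lra).
set (sg := fun u v => form_disc k * eps * g k (N u v) (emb k v (frame_normal k p q s u))).
assert (hsg : forall u v, open_itv a b u -> rot_range k v -> sg u v * sg u v = 1)
  by (intros; eapply unit_normal_pointwise; eauto).
exists (sg u0 0); split; auto.
intros u v hu hv.
destruct (unit_normal_pointwise _ _ _ _ _ _ _ _ u v hM hN hu hv) as [_ ->].
fold (sg u v); do 2 f_equal.
enough (0 < sg u0 0 * sg u v).
{ destruct (sqr_eq_1 _ (hsg u v hu hv)), (sqr_eq_1 _ (hsg u0 0 hu0 hv0)); nra. }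
assert (hD : forall t, open_itv a b (seg u0 u t) /\ rot_range k (seg 0 v t))
  by (intros t; split; [now apply seg_open_itv|now apply seg_rot_range]).
assert (E := ivt_same_sign (fun t => sg (seg u0 u t) (seg 0 v t))); cbv beta in E.
rewrite !seg_0, !seg_1 in E; apply E; clear E; intros t;
  destruct (hD t) as [h1 h2].
- unfold sg; apply @continuous_mult; [apply continuous_const|].
  apply (continuous_g k (fun t => N (seg u0 u t) (seg 0 v t))
    (fun t => emb k (seg 0 v t) (frame_normal k p q s (seg u0 u t)))).
  destruct hN as [_ [hN1 [hN2 [hN3 hN4]]]].
  intros x hx; split.
  + destruct hx as [-> | [-> | [-> | ->]]];
    [apply (continuous_along _ _ (seg u0 u) (seg 0 v) t hN1)
    |apply (continuous_along _ _ (seg u0 u) (seg 0 v) t hN2)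
    |apply (continuous_along _ _ (seg u0 u) (seg 0 v) t hN3)
    |apply (continuous_along _ _ (seg u0 u) (seg 0 v) t hN4)];
    try apply continuous_seg; intros; apply hD.
  + assert (K : forall y, y = y1 \/ y = y2 \/ y = y3 ->
      continuous (fun t => y (frame_normal k p q s (seg u0 u t))) t).
    { intros y hy.
      apply (continuous_comp (seg u0 u) (fun t => y (frame_normal k p q s t)));
        [apply continuous_seg|].
      eapply continuous_frame_normal; eauto. }
    (* The frame normal is regarded as a curve through its three coordinate functions. *)
    refine (continuous_ext _ _ _ _ (continuous_curve_emb k
       (fun u => y1 (frame_normal k p q s u)) (fun u => y2 (frame_normal k p q s u))
       (fun u => y3 (frame_normal k p q s u)) (seg u0 u) (seg 0 v) t _ _ _ _ x hx));
      try apply K; auto using continuous_seg.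
- intros E; generalize (hsg _ _ h1 h2); rewrite E; lra.
Qed.

(** * Fundamental forms *)

(** Up to sign, the Wronskian of the two profile functions other than the radius or, in the
    parabolic case, of x and z. *)
Definition wronskian (k : rot_type) (p q s : R -> R) (u : R) : R :=
  det3 (curve p q s u) (curve (Derive p) (Derive q) (Derive s) u) (axis k).

(* [eps f - t], except [- (f + t)] for the second hyperbolic family (where [eps = 1]). *)
Definition curvature_gap (k : rot_type) (eps : R) (f : R -> R) (t : R) : R :=
  - form_disc k * eps * f t - t.

Lemma radius_derivable (k : rot_type) (eps : R) (a b : Rbar) (p q s : R -> R) (u : R) :
  rotational_surface k eps a b p q s -> open_itv a b u ->
  ex_derive (radius k p q s) u /\ ex_derive (Derive (radius k p q s)) u.
Proof.
intros [_ [_ [hp [hq [hs _]]]]] hu; destruct k; simpl; split;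
  try apply (hp u hu); try apply (hq u hu); apply (hs u hu).
Qed.

Lemma first_fundamental_form (k : rot_type) (eps : R) (a b : Rbar) (p q s : R -> R) (u v : R) :
  rotational_surface k eps a b p q s -> open_itv a b u ->
  let X := rot k p q s in
  g k (du X u v) (du X u v) = eps /\ g k (du X u v) (dv X u v) = 0 /\
  g k (dv X u v) (dv X u v) = - form_disc k * radius k p q s u ^ 2.
Proof.
intros hM hu X; destruct (frame_of_surface _ _ _ _ _ _ _ u hM hu) as [_ [_ [_ [h _]]]].
destruct hM as [_ [_ [hp [hq [hs _]]]]].
unfold X; rewrite dv_rot, du_rot; try apply (hp u hu); try apply (hq u hu);
  try apply (hs u hu).
rewrite g_emb; repeat split; auto.
- rewrite g_sym, g_smul, g_sym, g_emb_tang; ring.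
- rewrite g_smul, g_sym, g_smul, g_tang; ring.
Qed.

(** The second derivatives of X are the rotated r'', a multiple of [tang k v], and the radius times
    the rotated axis. The middle one is orthogonal to the image of [emb k v]; the other two pair
    with n as determinants by [form_normal]. *)
Lemma second_fundamental_form (k : rot_type) (eps : R) (a b : Rbar) (p q s : R -> R)
    (sg u v : R) :
  rotational_surface k eps a b p q s -> open_itv a b u ->
  let X := rot k p q s in
  let n := emb k v (smul3 sg (frame_normal k p q s u)) in
  g k (du (du X) u v) n = sg * det3 (curve p q s u)
    (curve (Derive p) (Derive q) (Derive s) u)
    (curve (Derive (Derive p)) (Derive (Derive q)) (Derive (Derive s)) u) /\
  g k (du (dv X) u v) n = 0 /\
  g k (dv (dv X) u v) n = sg * (radius k p q s u * wronskian k p q s u).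
Proof.
intros [_ [_ [hp [hq [hs _]]]]] hu X n; unfold X, n; repeat split.
(* The formula for the first derivative holds only for parameters in the open interval, hence the
   local form of extensionality. *)
- rewrite (du_ext_loc _ (rot k (Derive p) (Derive q) (Derive s))).
  + rewrite du_rot; try apply (hp u hu); try apply (hq u hu); try apply (hs u hu).
    unfold frame_normal; rewrite g_emb, form_smul, form_sym. now rewrite form_normal.
  + generalize (locally_open_itv _ _ _ hu); apply filter_imp; intros t ht.
    rewrite rot_emb; apply du_rot; [apply (hp t ht)|apply (hq t ht)|apply (hs t ht)].
- rewrite (du_ext_loc _ (fun u v => smul4 (radius k p q s u) (tang k v))).
  + rewrite du_tang, g_smul, g_sym, g_emb_tang; ring.
  + apply filter_forall; intros t; apply dv_rot.
- rewrite (dv_ext _ (fun u v => smul4 (radius k p q s u) (tang k v))).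
  + rewrite dv_tang, g_emb, form_smul, form_sym, form_smul.
    unfold frame_normal, wronskian; rewrite form_normal; ring.
  + intros t; apply dv_rot.
Qed.

(** In the product rule the term det (r', r', axis) vanishes. *)
Lemma is_derive_wronskian (k : rot_type) (eps : R) (a b : Rbar) (p q s : R -> R) (u : R) :
  rotational_surface k eps a b p q s -> open_itv a b u ->
  is_derive (wronskian k p q s) u (det3 (curve p q s u)
    (curve (Derive (Derive p)) (Derive (Derive q)) (Derive (Derive s)) u) (axis k)).
Proof.
intros [_ [_ [hp [hq [hs _]]]]] hu.
destruct (hp u hu) as [? [? _]], (hq u hu) as [? [? _]], (hs u hu) as [? [? _]].
unfold wronskian, det3; destruct k; simpl; auto_derive; repeat split; auto; eta_derive; ring.
Qed.

Lemma form_axis_derive (k : rot_type) (p q s : R -> R) (u : R) :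
  form k (curve (Derive p) (Derive q) (Derive s) u) (axis k) =
  form_disc k * Derive (radius k p q s) u.
Proof. destruct k; simpl; ring. Qed.

(* Gram determinants of (r, r', n) and (r, r'', axis): the Codazzi equation. *)
Lemma wronskian_derive_eq (k : rot_type) (eps : R) (a b : Rbar) (p q s : R -> R) (u : R) :
  rotational_surface k eps a b p q s -> open_itv a b u ->
  let r := curve p q s u in
  let r' := curve (Derive p) (Derive q) (Derive s) u in
  let r'' := curve (Derive (Derive p)) (Derive (Derive q)) (Derive (Derive s)) u in
  det3 r r'' (axis k) =
  - form_disc k * eps * Derive (radius k p q s) u * det3 r r' r''.
Proof.
intros hM hu r r' r''.
destruct (frame_of_surface _ _ _ _ _ _ _ u hM hu) as [_ [h1 [h2 [h3 [h4 h5]]]]].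
assert (hn := frame_normal_norm _ _ _ _ _ _ _ u hM hu).
assert (heps := rotational_eps _ _ _ _ _ _ _ hM); assert (hd := form_disc_sqr k).
assert (ha := form_axis k p q s u); assert (hb := form_axis_derive k p q s u).
assert (G := gram k r r' (frame_normal k p q s u) r r'' (axis k)).
rewrite <- (form_normal k) in G.
assert (E : form k (frame_normal k p q s u) r = 0).
{ unfold frame_normal; rewrite form_normal; unfold r, det3; simpl; ring. }
assert (E' : form k (frame_normal k p q s u) r'' = det3 r r' r'')
  by apply form_normal.
change (normal k r r') with (frame_normal k p q s u) in G.
fold r r' r'' in h1, h2, h3, h4, h5, ha, hb.
(* The Gram matrix now has first column (1, 0, 0), and (r', r'') = 0, so its determinant reduces to
   - (r', axis) (n, r''). *)
rewrite hn, h1, h4, (form_sym k r' r), h2, h5, ha, hb, E, E' in G.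
transitivity (form_disc k * form_disc k * (eps * eps) * det3 r r'' (axis k));
  [rewrite hd, heps; ring|].
replace (form_disc k * form_disc k * (eps * eps) * det3 r r'' (axis k)) with
  (eps * (form_disc k * (form_disc k * eps) * det3 r r'' (axis k))) by ring.
rewrite G; ring.
Qed.

(** The Gram determinant of (r, r', axis) with itself equals [form_disc k] times the squared
    Wronskian, and it contains the squared derivative of the radius through (r', axis). *)
Lemma radius_derive_sqr (k : rot_type) (eps : R) (a b : Rbar) (p q s : R -> R) (u : R) :
  rotational_surface k eps a b p q s -> open_itv a b u ->
  Derive (radius k p q s) u ^ 2 =
  eps * form k (axis k) (axis k) - eps * radius k p q s u ^ 2
  - form_disc k * wronskian k p q s u ^ 2.
Proof.
intros hM hu.
destruct (frame_of_surface _ _ _ _ _ _ _ u hM hu) as [_ [h1 [h2 [h3 _]]]].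
assert (hd := form_disc_sqr k).
assert (G := gram k (curve p q s u) (curve (Derive p) (Derive q) (Derive s) u) (axis k)
  (curve p q s u) (curve (Derive p) (Derive q) (Derive s) u) (axis k)).
assert (ha := form_axis k p q s u); assert (hb := form_axis_derive k p q s u).
assert (ha' := ha); rewrite form_sym in ha'; assert (hb' := hb); rewrite form_sym in hb'.
assert (h2' := h2); rewrite form_sym in h2'.
rewrite h1, h2, h2', h3, ha, ha', hb, hb' in G.
fold (wronskian k p q s u) in G.
set (w := wronskian k p q s u) in *; set (d := Derive _ u) in *.
set (rho := radius k p q s u) in *.
transitivity (form_disc k * form_disc k * d ^ 2); [rewrite hd; ring|].
replace (form_disc k * w ^ 2) with (form_disc k * w * w) by ring; rewrite G.
replace (rho ^ 2) with (form_disc k * form_disc k * rho ^ 2) by (rewrite hd; ring); ring.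
Qed.

Lemma rot_range_0 (k : rot_type) : rot_range k 0.
Proof. destruct k; simpl; auto; generalize PI_RGT_0; lra. Qed.

Lemma lambda_eq (k : rot_type) (eps : R) (a b : Rbar) (p q s : R -> R)
    (N : R -> R -> vec4) (sg u v : R) :
  rotational_surface k eps a b p q s -> open_itv a b u ->
  N u v = emb k v (smul3 sg (frame_normal k p q s u)) ->
  lambda k (rot k p q s) N u v = sg * wronskian k p q s u / radius k p q s u.
Proof.
intros hM hu hN.
destruct (frame_of_surface _ _ _ _ _ _ _ u hM hu) as [h _].
destruct (first_fundamental_form _ _ _ _ _ _ _ u v hM hu) as [_ [_ h1]].
destruct (second_fundamental_form _ _ _ _ _ _ _ sg u v hM hu) as [_ [_ h2]].
unfold lambda; rewrite hN, h1, h2.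
replace (Rabs (- form_disc k * radius k p q s u ^ 2)) with (radius k p q s u ^ 2).
- field; lra.
- rewrite Rabs_mult, (Rabs_pos_eq (_ ^ 2)) by nra.
  replace (Rabs (- form_disc k)) with 1; [ring|].
  destruct k; simpl; unfold Rabs; destruct (Rcase_abs _); lra.
Qed.

(** Quotient rule for [sg] W / rho. By [wronskian_derive_eq], W' is - d eps rho' det (r, r', r''),
    and [sg] times this determinant is kappa, that is, f(lambda). *)
Lemma lambda_derive (k : rot_type) (eps : R) (a b : Rbar) (p q s : R -> R)
    (N : R -> R -> vec4) (f : R -> R) (sg u v : R) :
  rotational_surface k eps a b p q s -> rot_range k v ->
  (forall u v, open_itv a b u -> rot_range k v ->
     N u v = emb k v (smul3 sg (frame_normal k p q s u))) ->
  (forall u v, open_itv a b u -> rot_range k v ->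
     kappa k (rot k p q s) N u v = f (lambda k (rot k p q s) N u v)) ->
  open_itv a b u ->
  is_derive (fun u => lambda k (rot k p q s) N u v) u
    (curvature_gap k eps f (lambda k (rot k p q s) N u v) *
     Derive (radius k p q s) u / radius k p q s u).
Proof.
intros hM hv hN hW hu.
destruct (frame_of_surface _ _ _ _ _ _ _ u hM hu) as [h _].
destruct (second_fundamental_form _ _ _ _ _ _ _ sg u v hM hu) as [h2 _].
assert (hd := is_derive_wronskian _ _ _ _ _ _ _ u hM hu).
destruct (radius_derivable _ _ _ _ _ _ _ u hM hu) as [hr _].
rewrite (wronskian_derive_eq _ _ _ _ _ _ _ u hM hu) in hd.
assert (hk : kappa k (rot k p q s) N u v = f (lambda k (rot k p q s) N u v)) by now apply hW.
unfold kappa in hk; rewrite (hN u v hu hv), h2 in hk.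
unfold curvature_gap; rewrite <- hk.
apply (is_derive_ext_loc (fun t => sg * wronskian k p q s t / radius k p q s t)).
- generalize (locally_open_itv _ _ _ hu); apply filter_imp; intros t ht.
  symmetry; eapply lambda_eq; eauto.
- rewrite (lambda_eq k eps a b p q s N sg u v hM hu (hN u v hu hv)).
  set (c := det3 _ _ _) in *.
  auto_derive.
  + repeat split; auto; [eexists; eauto|lra].
  + eta_derive; rewrite (is_derive_unique _ _ _ hd); field; lra.
Qed.

(** Continuity is read off the quotient rule itself, which involves derivatives of the profile
    functions of order at most two. *)
Lemma lambda_derive_continuous (k : rot_type) (eps : R) (a b : Rbar) (p q s : R -> R)
    (N : R -> R -> vec4) (sg u v : R) :
  rotational_surface k eps a b p q s -> rot_range k v ->
  (forall u v, open_itv a b u -> rot_range k v ->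
     N u v = emb k v (smul3 sg (frame_normal k p q s u))) ->
  open_itv a b u ->
  continuous (Derive (fun u => lambda k (rot k p q s) N u v)) u.
Proof.
intros hM hv hN hu.
destruct (frame_of_surface _ _ _ _ _ _ _ u hM hu) as [h _].
destruct (radius_derivable _ _ _ _ _ _ _ u hM hu) as [hr hr'].
assert (hd := is_derive_wronskian _ _ _ _ _ _ _ u hM hu).
apply (continuous_ext_loc _ (fun t => sg * (det3 (curve p q s t)
  (curve (Derive (Derive p)) (Derive (Derive q)) (Derive (Derive s)) t) (axis k)
  * / radius k p q s t +
  - (wronskian k p q s t * Derive (radius k p q s) t * / radius k p q s t
     * / radius k p q s t)))).
- generalize (locally_open_itv _ _ _ hu); apply filter_imp; intros t ht.
  symmetry; apply is_derive_unique.
  apply (is_derive_ext_loc (fun t => sg * wronskian k p q s t / radius k p q s t)).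
  + generalize (locally_open_itv _ _ _ ht); apply filter_imp; intros w hw.
    symmetry; eapply lambda_eq; eauto.
  + destruct (frame_of_surface _ _ _ _ _ _ _ t hM ht) as [ht0 _].
    destruct (radius_derivable _ _ _ _ _ _ _ t hM ht) as [htr _].
    assert (htd := is_derive_wronskian _ _ _ _ _ _ _ t hM ht).
    auto_derive.
    * repeat split; auto; [eexists; eauto|lra].
    * eta_derive; rewrite (is_derive_unique _ _ _ htd); field; lra.
- assert (c1 : continuous (wronskian k p q s) u)
    by (apply @ex_derive_continuous; eexists; eauto).
  assert (c2 : continuous (fun t => / radius k p q s t) u).
  { apply (continuous_comp _ Rinv); [now apply @ex_derive_continuous|].
    apply continuous_Rinv; lra. }
  assert (c3 : continuous (Derive (radius k p q s)) u) by now apply @ex_derive_continuous.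
  assert (c0 : forall r : R, continuous (fun _ : R => r) u)
    by (intros; apply continuous_const).
  assert (c4 : continuous (fun t => det3 (curve p q s t)
    (curve (Derive (Derive p)) (Derive (Derive q)) (Derive (Derive s)) t) (axis k)) u).
  { destruct hM as [_ [_ [hp [hq [hs _]]]]].
    destruct (hp u hu) as [hp0 [_ hp2]], (hq u hu) as [hq0 [_ hq2]],
      (hs u hu) as [hs0 [_ hs2]].
    apply ex_derive_continuous in hp0, hq0, hs0.
    unfold det3; simpl; unfold Rminus; repeat first [assumption | apply c0
      | apply @continuous_plus | apply @continuous_opp | apply @continuous_mult]. }
  repeat first [assumption | apply c0
      | apply @continuous_plus | apply @continuous_opp | apply @continuous_mult].
Qed.

Lemma curvature_gap_neq0 (k : rot_type) (eps : R) (a b : Rbar) (p q s : R -> R)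
    (N : R -> R -> vec4) (f : R -> R) (sg u v : R) :
  rotational_surface k eps a b p q s -> open_itv a b u ->
  N u v = emb k v (smul3 sg (frame_normal k p q s u)) ->
  kappa k (rot k p q s) N u v = f (lambda k (rot k p q s) N u v) ->
  ~ umbilical_at k (rot k p q s) N u v ->
  curvature_gap k eps f (lambda k (rot k p q s) N u v) <> 0.
Proof.
intros hM hu hN hW humb E; apply humb.
destruct (frame_of_surface _ _ _ _ _ _ _ u hM hu) as [h _].
assert (heps := rotational_eps _ _ _ _ _ _ _ hM); assert (hd := form_disc_sqr k).
destruct (first_fundamental_form _ _ _ _ _ _ _ u v hM hu) as [h1 [h2 h3]].
destruct (second_fundamental_form _ _ _ _ _ _ _ sg u v hM hu) as [_ [h5 h6]].
assert (hl := lambda_eq _ _ _ _ _ _ _ _ _ _ _ hM hu hN).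
unfold curvature_gap in E; rewrite <- hW in E.
(* The factor is forced by the profile direction, where the first fundamental form equals eps, its
   own inverse. *)
exists (eps * kappa k (rot k p q s) N u v); rewrite h1, h2, h3.
repeat split.
- unfold kappa at 1.
  transitivity (eps * eps * g k (du (du (rot k p q s)) u v) (N u v));
    [rewrite heps|unfold kappa]; ring.
- rewrite hN, h5; ring.
- rewrite hN at 1; rewrite h6.
  transitivity (lambda k (rot k p q s) N u v * radius k p q s u ^ 2).
  + rewrite hl; field; lra.
  + replace (lambda k (rot k p q s) N u v) with
      (- form_disc k * eps * kappa k (rot k p q s) N u v) by lra; ring.
Qed.

(** Substituting W = [sg] l rho into [radius_derive_sqr] leaves (axis, axis) as the only
    family-dependent term besides [form_disc]; it is 0 in the parabolic case, where rho^2 therefore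
    factors out. *)
Lemma radius_derive_positivity (k : rot_type) (eps : R) (a b : Rbar) (p q s : R -> R)
    (sg l u : R) :
  rotational_surface k eps a b p q s -> open_itv a b u -> sg * sg = 1 ->
  l = sg * wronskian k p q s u / radius k p q s u ->
  Derive (radius k p q s) u ^ 2 = positivity_term k eps l (radius k p q s u) *
    match k with Parabolic => radius k p q s u ^ 2 | _ => 1 end.
Proof.
intros hM hu hsg ->.
destruct (frame_of_surface _ _ _ _ _ _ _ u hM hu) as [h _].
rewrite (radius_derive_sqr _ _ _ _ _ _ _ u hM hu).
assert (E : (sg * wronskian k p q s u / radius k p q s u) ^ 2 =
  wronskian k p q s u ^ 2 / radius k p q s u ^ 2).
{ replace (wronskian k p q s u ^ 2) with (sg * sg * wronskian k p q s u ^ 2)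
    by (rewrite hsg; ring); field; lra. }
assert (he : k = Hyperbolic2 -> eps = 1).
{ intros ->; destruct hM as [_ [_ [_ [_ [_ [hc _]]]]]]; apply (hc u hu). }
destruct k; unfold positivity_term; rewrite E; simpl in *; try (rewrite he by reflexivity);
  field; lra.
Qed.

(** * Inverse functions on open intervals *)

Lemma ivt_itv (a b : Rbar) (h : R -> R) (x y t : R) :
  (forall u, open_itv a b u -> continuous h u) ->
  open_itv a b x -> open_itv a b y -> h x < t < h y ->
  exists u, open_itv a b u /\ h u = t.
Proof.
intros hc hx hy ht; apply NNPP; intros hn.
assert (E := ivt_same_sign (fun w => h (seg x y w) - t)); cbv beta in E.
rewrite !seg_0, !seg_1 in E; enough (0 < (h x - t) * (h y - t)) by nra.
apply E; clear E; intros w; assert (hw := seg_open_itv a b x y w hx hy).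
- apply @continuous_minus; [|apply continuous_const].
  apply (continuous_comp (seg x y) h); [apply continuous_seg|now apply hc].
- intros E; apply hn; exists (seg x y w); split; auto; lra.
Qed.

Lemma open_itv_neighbours (a b : Rbar) (u : R) : open_itv a b u ->
  exists x y, x < u < y /\ forall w, x <= w <= y -> open_itv a b w.
Proof.
intros hu; destruct (locally_open_itv _ _ _ hu) as [[e he] H]; simpl in H.
exists (u - e / 2), (u + e / 2); split; [lra|].
intros w hw; apply H; unfold ball; simpl; unfold AbsRing_ball, abs, minus, plus, opp; simpl.
apply Rabs_def1; lra.
Qed.

Lemma inverse_increasing (a b : Rbar) (h : R -> R) :
  (forall u, open_itv a b u -> ex_derive h u) ->
  (forall u, open_itv a b u -> 0 < Derive h u) ->
  exists (al be : Rbar) (mu : R -> R),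
    change_of_parameter (open_itv a b) h al be mu.
Proof.
intros hd hpos.
assert (hinc : forall x y, open_itv a b x -> open_itv a b y -> x < y -> h x < h y).
{ intros x y hx hy hxy; apply (incr_function h a b (Derive h)); auto;
    try apply hx; try apply hy; intros; try apply Derive_correct, hd; try apply hpos;
    now split. }
assert (hinj : forall x y, open_itv a b x -> open_itv a b y -> h x = h y -> x = y).
{ intros x y hx hy hxy; destruct (Rtotal_order x y) as [l|[|l]]; auto;
    apply hinc in l; auto; lra. }
set (E := fun t => exists u, open_itv a b u /\ h u = t).
(* [mu] picks a preimage; its values off the image of [h] are arbitrary. *)
set (mu := fun t => epsilon (inhabits 0) (fun u => open_itv a b u /\ h u = t)).
assert (hmu : forall t, E t -> open_itv a b (mu t) /\ h (mu t) = t)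
  by (intros t ht; apply (epsilon_spec _ _ ht)).
(* The new parameter interval runs from the infimum to the supremum of the image, possibly
   infinite. *)
destruct (Glb_Rbar_correct E) as [hal1 hal2], (Lub_Rbar_correct E) as [hbe1 hbe2].
set (al := Glb_Rbar E) in *; set (be := Lub_Rbar E) in *.
assert (hE : forall t, open_itv al be t -> E t).
{ intros t [h1 h2].
  assert (exists x, E x /\ x < t) as [x [[u [hu <-]] hx]].
  { apply NNPP; intros hn; apply (Rbar_lt_not_le _ _ h1), hal2.
    intros x hx; simpl; apply Rnot_lt_le; intros hlt; apply hn; eauto. }
  assert (exists y, E y /\ t < y) as [y [[w [hw <-]] hy]].
  { apply NNPP; intros hn; apply (Rbar_lt_not_le _ _ h2), hbe2.
    intros y hy; simpl; apply Rnot_lt_le; intros hlt; apply hn; eauto. }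
  apply (ivt_itv a b h u w); auto.
  intros z hz; now apply @ex_derive_continuous, hd. }
(* The infimum and supremum are not attained: u has neighbours x < u < y in the interval, and h x <
   h u < h y. *)
assert (hE' : forall u, open_itv a b u -> open_itv al be (h u)).
{ intros u hu; destruct (open_itv_neighbours _ _ _ hu) as [x [y [hxy H]]].
  assert (hx : open_itv a b x) by (apply H; lra).
  assert (hy : open_itv a b y) by (apply H; lra).
  split.
  - apply Rbar_le_lt_trans with (h x); [apply hal1; now exists x|].
    apply hinc; auto; lra.
  - apply Rbar_lt_le_trans with (h y); [|apply hbe1; now exists y].
    apply hinc; auto; lra. }
exists al, be, mu; split.
- intros u hu; split; [|split]; auto.
  destruct (hmu (h u)) as [h1 h2]; [now exists u|now apply hinj].
- intros t ht; destruct (hmu t (hE t ht)) as [h1 h2]; split; [|split]; auto.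
  destruct (open_itv_neighbours _ _ _ h1) as [x [y [hxy H]]].
  (* Between h x and h y, [mu] is a right inverse with values in [x, y]; this is the compact setting
     of [derivable_pt_recip_interv]. *)
  assert (K : forall w, h x <= w <= h y -> h (mu w) = w /\ x <= mu w <= y).
  { intros w hw; destruct (hmu w) as [k1 k2].
    { apply hE; destruct (hE' x), (hE' y); try (apply H; lra); split.
      - apply Rbar_lt_le_trans with (h x); simpl; auto; lra.
      - apply Rbar_le_lt_trans with (h y); simpl; auto; lra. }
    split; auto; split; apply Rnot_lt_le; intros hlt; apply hinc in hlt; auto;
      try (apply H; lra); lra. }
  assert (hpr : forall c, x <= c <= y -> derivable_pt h c)
    by (intros c hc; apply ex_derive_Reals_0, hd, H, hc).
  apply ex_derive_Reals_1.
  assert (hxy' : x < y) by lra.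
  assert (ht' : h x < t < h y).
  { rewrite <- h2; split; apply hinc; auto; try (apply H; lra); lra. }
  apply (derivable_pt_recip_interv h mu x y t hxy' ht'
    (fun w p1 p2 => proj1 (K w (conj p1 p2))) (fun w p1 p2 => proj2 (K w (conj p1 p2)))
    (fun w z p1 p2 p3 => hinc w z (H w (conj p1 (Rle_trans _ _ _ (Rlt_le _ _ p2) p3)))
       (H z (conj (Rle_trans _ _ _ p1 (Rlt_le _ _ p2)) p3)) p2) hpr).
  rewrite Derive_Reals; apply Rgt_not_eq, hpos, h1.
Qed.

Lemma open_itv_opp (a b : Rbar) (u : R) :
  open_itv (Rbar_opp b) (Rbar_opp a) u <-> open_itv a b (- u).
Proof.
unfold open_itv; destruct a, b; simpl; intuition lra.
Qed.

(** A continuous derivative without zeros has constant sign. The decreasing case follows from the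
    increasing one for - h by reflecting the parameter interval. *)
Lemma inverse_monotone (a b : Rbar) (h : R -> R) :
  (forall u, open_itv a b u -> ex_derive h u) ->
  (forall u, open_itv a b u -> continuous (Derive h) u) ->
  (forall u, open_itv a b u -> Derive h u <> 0) ->
  exists (al be : Rbar) (mu : R -> R),
    change_of_parameter (open_itv a b) h al be mu.
Proof.
intros hd hc hn; destruct (sign_const _ _ _ hc hn) as [sg [[-> | ->] hpos]].
- apply inverse_increasing; auto; intros u hu; generalize (hpos u hu); lra.
- destruct (inverse_increasing a b (fun u => - h u)) as [al [be [mu [H1 H2]]]].
  + intros u hu; apply @ex_derive_opp; auto.
  + intros u hu; rewrite Derive_opp; generalize (hpos u hu); lra.
  + exists (Rbar_opp be), (Rbar_opp al), (fun t => mu (- t)); split.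
    * intros u hu; destruct (H1 u hu) as [h1 [h2 _]]; rewrite open_itv_opp; auto.
    * intros t ht; apply open_itv_opp in ht; destruct (H2 _ ht) as [h1 [h2 h3]].
      split; [|split]; auto; [lra|].
      apply (ex_derive_comp mu Ropp); auto; auto_derive; auto.
Qed.

Lemma change_of_parameter_derive (J : R -> Prop) (lam mu : R -> R) (al be : Rbar) (t : R) :
  change_of_parameter J lam al be mu -> open_itv al be t ->
  is_derive mu t (/ Derive lam (mu t)).
Proof.
intros [H1 H2] ht; destruct (H2 t ht) as [h1 [h2 h3]], (H1 _ h1) as [_ [_ h4]].
assert (E : Derive mu t * Derive lam (mu t) = 1).
{ rewrite <- (Derive_comp lam mu); auto; rewrite <- (Derive_id t); apply Derive_ext_loc.
  generalize (locally_open_itv _ _ _ ht); apply filter_imp; intros w hw; apply H2, hw. }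
replace (/ Derive lam (mu t)) with (Derive mu t); [now apply Derive_correct|].
apply (Rmult_eq_reg_r (Derive lam (mu t))).
- rewrite E, Rinv_l; auto; intros E0; rewrite E0 in E; lra.
- intros E0; rewrite E0 in E; lra.
Qed.

(** * Angles *)

(** Hyperbolic polar coordinates from null coordinates: for A = x + y and B = x - y, the hyperbolic
    angle of (x, y) is half the logarithm of A / B. The proof writes A and B as squares of
    exponentials. *)
Lemma half_ln_ratio (A B : R) : 0 < A -> 0 < B ->
  sqrt (A * B) * cosh ((ln A - ln B) / 2) = (A + B) / 2 /\
  sqrt (A * B) * sinh ((ln A - ln B) / 2) = (A - B) / 2.
Proof.
intros hA hB.
assert (eA : exp (ln A / 2) * exp (ln A / 2) = A)
  by (rewrite <- exp_plus; transitivity (exp (ln A)); [f_equal; field|now apply exp_ln]).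
assert (eB : exp (ln B / 2) * exp (ln B / 2) = B)
  by (rewrite <- exp_plus; transitivity (exp (ln B)); [f_equal; field|now apply exp_ln]).
assert (pA := exp_pos (ln A / 2)); assert (pB := exp_pos (ln B / 2)).
assert (E1 : exp ((ln A - ln B) / 2) = exp (ln A / 2) / exp (ln B / 2)).
{ unfold Rdiv at 2; rewrite <- exp_Ropp, <- exp_plus; f_equal; field. }
assert (E2 : exp (- ((ln A - ln B) / 2)) = exp (ln B / 2) / exp (ln A / 2)).
{ unfold Rdiv at 2; rewrite <- exp_Ropp, <- exp_plus; f_equal; field. }
unfold cosh, sinh; rewrite E1, E2.
set (x := exp (ln A / 2)) in *; set (y := exp (ln B / 2)) in *.
replace (A * B) with ((x * y) * (x * y)) by (rewrite <- eA, <- eB; ring).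
rewrite sqrt_square by nra; rewrite <- eA, <- eB; split; field; lra.
Qed.

Lemma constant_on_itv (a b : Rbar) (h : R -> R) :
  (forall u, open_itv a b u -> is_derive h u 0) ->
  forall x y, open_itv a b x -> open_itv a b y -> h x = h y.
Proof.
assert (K : forall h : R -> R, (forall u, open_itv a b u -> is_derive h u 0) ->
  forall x y, x < y -> open_itv a b x -> open_itv a b y -> h x = h y).
{ intros f hf x y hxy [h1 h2] [h3 h4]; apply (eq_is_derive f x y); auto.
  intros t ht; apply hf; split.
  - apply Rbar_lt_le_trans with x; simpl; auto; lra.
  - apply Rbar_le_lt_trans with y; simpl; auto; lra. }
intros hh x y hx hy; destruct (Rtotal_order x y) as [l|[->|l]]; auto.
symmetry; auto.
Qed.

Lemma primitive_on_itv (a b : Rbar) (h : R -> R) (u0 : R) :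
  open_itv a b u0 -> (forall u, open_itv a b u -> continuous h u) ->
  forall u, open_itv a b u -> is_derive (fun u => RInt h u0 u) u (h u).
Proof.
intros h0 hc u hu; apply is_derive_RInt with u0; [|now apply hc].
generalize (locally_open_itv _ _ _ hu); apply filter_imp; intros w hw.
apply @RInt_correct, @ex_RInt_continuous; intros z hz; apply hc.
destruct h0 as [k1 k2], hw as [k3 k4]; split.
- apply Rbar_lt_le_trans with (Rmin u0 w); [|apply hz].
  unfold Rmin; destruct (Rle_dec u0 w); auto.
- apply Rbar_le_lt_trans with (Rmax u0 w); [apply hz|].
  unfold Rmax; destruct (Rle_dec u0 w); auto.
Qed.

Lemma polar_point (x y : R) :
  exists t, x = sqrt (x ^ 2 + y ^ 2) * cos t /\ y = sqrt (x ^ 2 + y ^ 2) * sin t.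
Proof.
set (r := sqrt (x ^ 2 + y ^ 2)).
assert (hr : 0 <= r) by apply sqrt_pos.
assert (hrr : r * r = x ^ 2 + y ^ 2) by (apply sqrt_sqrt; nra).
destruct (Req_dec r 0) as [E|hn].
{ exists 0; rewrite E in *; split; nra. }
assert (hx : -1 <= x / r <= 1).
{ split; [apply Rmult_le_reg_r with r|apply Rmult_le_reg_r with r]; try lra;
    unfold Rdiv; rewrite Rmult_assoc, Rinv_l, Rmult_1_r; auto; nra. }
assert (hs : r * sqrt (1 - (x / r)²) = Rabs y).
{ rewrite <- (sqrt_square r) at 1; auto; rewrite <- sqrt_mult; try nra.
  - replace (r * r * (1 - (x / r)²)) with (Rsqr y); [apply sqrt_Rsqr_abs|].
    unfold Rsqr; replace (y * y) with (r * r - x * x) by (rewrite hrr; ring); field; auto.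
  - unfold Rsqr; nra. }
(* [acos] covers the upper half-plane only; for y < 0 the angle is negated. *)
destruct (Rle_lt_dec 0 y) as [hy|hy].
- exists (acos (x / r)); rewrite cos_acos, sin_acos; auto; rewrite hs, Rabs_pos_eq; auto.
  split; auto; field; auto.
- exists (- acos (x / r)); rewrite cos_neg, sin_neg, cos_acos, sin_acos; auto.
  rewrite Ropp_mult_distr_r_reverse, hs, Rabs_left; auto.
  split; [field; auto|ring].
Qed.

(** The angle is the integral of the angular velocity, started at a polar angle of one chosen point;
    no branches of an inverse trigonometric function have to be glued. *)
Lemma polar_angle (a b : Rbar) (x y : R -> R) :
  (forall u, open_itv a b u -> ex_derive x u /\ continuous (Derive x) u) ->
  (forall u, open_itv a b u -> ex_derive y u /\ continuous (Derive y) u) ->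
  (forall u, open_itv a b u -> 0 < x u ^ 2 + y u ^ 2) ->
  exists phi : R -> R, forall u, open_itv a b u ->
    is_derive phi u ((x u * Derive y u - y u * Derive x u) / (x u ^ 2 + y u ^ 2)) /\
    x u = sqrt (x u ^ 2 + y u ^ 2) * cos (phi u) /\
    y u = sqrt (x u ^ 2 + y u ^ 2) * sin (phi u).
Proof.
intros hx hy hpos.
destruct (classic (exists u, open_itv a b u)) as [[u0 h0]|hempty];
  [|exists (fun _ => 0); intros u hu; destruct hempty; eauto].
set (th := fun u => (x u * Derive y u - y u * Derive x u) / (x u ^ 2 + y u ^ 2)).
destruct (polar_point (x u0) (y u0)) as [t0 [ht1 ht2]].
set (phi := fun u => t0 + RInt th u0 u).
assert (hth : forall u, open_itv a b u -> continuous th u).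
{ intros u hu; destruct (hx u hu) as [hx1 hx2], (hy u hu) as [hy1 hy2].
  apply ex_derive_continuous in hx1, hy1; assert (hp := hpos u hu).
  unfold th; apply @continuous_mult.
  - unfold Rminus; repeat first [assumption
      | apply @continuous_plus | apply @continuous_opp | apply @continuous_mult].
  - apply (continuous_comp (fun u => x u ^ 2 + y u ^ 2) Rinv);
      [|apply continuous_Rinv; lra].
    simpl; repeat first [assumption | apply continuous_const
      | apply @continuous_plus | apply @continuous_mult]. }
assert (hphi : forall u, open_itv a b u -> is_derive phi u (th u)).
{ intros u hu; unfold phi; rewrite <- (Rplus_0_l (th u)).
  apply @is_derive_plus; [apply @is_derive_const|].
  now apply (primitive_on_itv a b). }
set (r := fun u => sqrt (x u ^ 2 + y u ^ 2)).
set (rho := fun u => (x u * Derive x u + y u * Derive y u) / (x u ^ 2 + y u ^ 2)).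
(* (x + i y) exp (- i phi) and r satisfy the same linear equation z' = rho z. *)
set (c := fun u => x u * cos (phi u) + y u * sin (phi u)).
set (s := fun u => y u * cos (phi u) - x u * sin (phi u)).
assert (hr : forall u, open_itv a b u -> 0 < r u)
  by (intros u hu; apply sqrt_lt_R0, hpos, hu).
assert (dr : forall u, open_itv a b u -> is_derive r u (rho u * r u)).
{ intros u hu; destruct (hx u hu) as [hx1 _], (hy u hu) as [hy1 _].
  assert (hp := hpos u hu); assert (hru := hr u hu).
  assert (hrr : r u * r u = x u ^ 2 + y u ^ 2) by (apply sqrt_sqrt; lra).
  unfold r at 1; auto_derive; [simpl in hp; repeat split; auto; lra|].
  eta_derive; unfold rho.
  replace (sqrt _) with (r u) by (unfold r; do 2 f_equal; ring).
  rewrite <- hrr; field; lra. }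
assert (dc : forall u, open_itv a b u -> is_derive c u (rho u * c u)).
{ intros u hu; destruct (hx u hu) as [hx1 _], (hy u hu) as [hy1 _].
  assert (hp := hpos u hu); assert (hd := hphi u hu).
  unfold c at 1; auto_derive; [repeat split; auto; eexists; eauto|].
  eta_derive; rewrite (is_derive_unique _ _ _ hd); unfold rho, c, th; field; lra. }
assert (ds : forall u, open_itv a b u -> is_derive s u (rho u * s u)).
{ intros u hu; destruct (hx u hu) as [hx1 _], (hy u hu) as [hy1 _].
  assert (hp := hpos u hu); assert (hd := hphi u hu).
  unfold s at 1; auto_derive; [repeat split; auto; eexists; eauto|].
  eta_derive; rewrite (is_derive_unique _ _ _ hd); unfold rho, s, th; field; lra. }
(* Every solution of z' = rho z is a constant multiple of r, since its quotient by r has derivative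
   0. *)
assert (K : forall h : R -> R, (forall u, open_itv a b u -> is_derive h u (rho u * h u)) ->
  forall u, open_itv a b u -> h u = h u0 / r u0 * r u).
{ intros h dh u hu; assert (p := hr u hu); assert (p0 := hr u0 h0).
  assert (E : h u / r u = h u0 / r u0).
  { apply (constant_on_itv a b (fun u => h u / r u)); auto.
    intros w hw; assert (d1 := dh w hw); assert (d2 := dr w hw); assert (pw := hr w hw).
    auto_derive; [repeat split; [eexists; eauto|eexists; eauto|lra]|].
    eta_derive; rewrite (is_derive_unique _ _ _ d1), (is_derive_unique _ _ _ d2).
    field; lra. }
  rewrite <- E; field; lra. }
assert (hphi0 : phi u0 = t0) by (unfold phi; rewrite RInt_point; unfold zero; simpl; ring).
assert (hsc := sin_sqr t0).
fold (r u0) in ht1, ht2; assert (p0 := hr u0 h0).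
exists phi; intros u hu; split; [now apply hphi|]; fold (r u).
(* The equalities c = r and s = 0 hold at [u0] by the choice of [t0], hence everywhere; rotating
   back by [phi] then recovers x and y. *)
assert (Ec : c u = r u).
{ rewrite (K c dc u hu); unfold c; rewrite hphi0, ht1, ht2.
  transitivity (r u * (cos t0 * cos t0 + sin t0 * sin t0)); [field; lra|rewrite hsc; ring]. }
assert (Es : s u = 0).
{ rewrite (K s ds u hu); unfold s; rewrite hphi0, ht1, ht2; field; lra. }
assert (hscu := sin_sqr (phi u)).
split.
- transitivity (c u * cos (phi u) - s u * sin (phi u)); [|rewrite Ec, Es; ring].
  unfold c, s.
  transitivity (x u * (cos (phi u) * cos (phi u) + sin (phi u) * sin (phi u)));
    [rewrite hscu|]; ring.
- transitivity (c u * sin (phi u) + s u * cos (phi u)); [|rewrite Ec, Es; ring].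
  unfold c, s.
  transitivity (y u * (cos (phi u) * cos (phi u) + sin (phi u) * sin (phi u)));
    [rewrite hscu|]; ring.
Qed.

(** * Parametrization by lambda *)

(** As the sign squares to 1, the sign times phi is an antiderivative of h; the additive constant is
    absorbed into it, so phi0 = 0. *)
Lemma pm_integral_of_derive (I : R -> Prop) (h phi : R -> R) (sg : R) :
  sg = 1 \/ sg = -1 -> (forall t, I t -> is_derive phi t (sg * h t)) ->
  pm_integral I h phi.
Proof.
intros hsg hphi; exists 0, sg, (fun t => sg * phi t); split; [|split]; auto.
- intros t ht; replace (h t) with (sg * (sg * h t)) by (destruct hsg as [-> | ->]; ring).
  now apply is_derive_scal, hphi.
- intros t ht; destruct hsg as [-> | ->]; ring.
Qed.

(** Here [sg] is the sign of x. As x^2 > y^2, both [sg] (x + y) and [sg] (x - y) are positive, and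
    [half_ln_ratio] applies to them. *)
Lemma hyperbolic_angle (x y : R -> R) (sg u : R) :
  sg * sg = 1 -> ex_derive x u -> ex_derive y u ->
  0 < sg * x u -> 0 < x u ^ 2 - y u ^ 2 ->
  let psi := fun u => (ln (sg * (x u + y u)) - ln (sg * (x u - y u))) / 2 in
  is_derive psi u ((x u * Derive y u - y u * Derive x u) / (x u ^ 2 - y u ^ 2)) /\
  x u = sg * (sqrt (x u ^ 2 - y u ^ 2) * cosh (psi u)) /\
  y u = sg * (sqrt (x u ^ 2 - y u ^ 2) * sinh (psi u)).
Proof.
intros hsg hx hy h1 h2 psi.
assert (hAB : sg * (x u + y u) * (sg * (x u - y u)) = x u ^ 2 - y u ^ 2).
{ transitivity (sg * sg * (x u ^ 2 - y u ^ 2)); [ring|rewrite hsg; ring]. }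
assert (hA : 0 < sg * (x u + y u)) by nra.
assert (hB : 0 < sg * (x u - y u)) by nra.
destruct (half_ln_ratio _ _ hA hB) as [hc hs]; fold (psi u) in hc, hs.
rewrite hAB in hc, hs; rewrite hc, hs.
split; [|split].
- unfold psi; auto_derive; [repeat split; auto; lra|].
  eta_derive; field; repeat split; try nra; intros E; rewrite E in *; nra.
- transitivity (sg * sg * x u); [rewrite hsg; ring|field].
- transitivity (sg * sg * y u); [rewrite hsg; ring|field].
Qed.

(* [mu] is the inverse of lambda on an interval where lambda has no critical point. *)
Definition lambda_parameter (k : rot_type) (eps : R) (f : R -> R) (a b : Rbar)
    (p q s : R -> R) (sg sgd : R) (I : R -> Prop) (mu : R -> R) : Prop :=
  sg * sg = 1 /\ sgd * sgd = 1 /\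
  forall t, I t -> open_itv a b (mu t) /\
    is_derive mu t (radius k p q s (mu t) /
      (curvature_gap k eps f t * Derive (radius k p q s) (mu t))) /\
    curvature_gap k eps f t <> 0 /\
    0 < sgd * Derive (radius k p q s) (mu t) /\
    wronskian k p q s (mu t) = sg * t * radius k p q s (mu t).

(** [sgd] is the sign of rho', so [sgd] rho' is the positive square root of the right-hand side of
    [radius_derive_positivity]. *)
Lemma lambda_parameter_sqrt (k : rot_type) (eps : R) (f : R -> R) (a b : Rbar)
    (p q s : R -> R) (sg sgd : R) (I : R -> Prop) (mu : R -> R) (t : R) :
  rotational_surface k eps a b p q s ->
  lambda_parameter k eps f a b p q s sg sgd I mu -> I t ->
  0 < positivity_term k eps t (radius k p q s (mu t)) /\
  Derive (radius k p q s) (mu t) = sgd *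
    (sqrt (positivity_term k eps t (radius k p q s (mu t))) *
     match k with Parabolic => radius k p q s (mu t) | _ => 1 end).
Proof.
intros hM [hsg [hsgd H]] ht; destruct (H t ht) as [hu [_ [_ [hpos hw]]]].
destruct (frame_of_surface _ _ _ _ _ _ _ _ hM hu) as [hr _].
assert (E : t = sg * wronskian k p q s (mu t) / radius k p q s (mu t)).
{ rewrite hw; transitivity (sg * sg * t); [rewrite hsg; ring|field; lra]. }
assert (hs := radius_derive_positivity _ _ _ _ _ _ _ sg t _ hM hu hsg E).
set (P := positivity_term k eps t (radius k p q s (mu t))) in *.
set (d := Derive (radius k p q s) (mu t)) in *.
set (rho := radius k p q s (mu t)) in *.
assert (hd : d ^ 2 = (sgd * d) ^ 2)
  by (transitivity (sgd * sgd * d ^ 2); [rewrite hsgd|]; ring).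
assert (hm : 0 < match k with Parabolic => rho ^ 2 | _ => 1 end)
  by (destruct k; try lra; nra).
assert (hP : 0 < P) by nra.
split; auto.
assert (K : sgd * d = sqrt P * match k with Parabolic => rho | _ => 1 end).
{ rewrite <- (sqrt_square (sgd * d)) by lra.
  replace (sgd * d * (sgd * d)) with (d ^ 2) by (rewrite hd; ring).
  rewrite hs, sqrt_mult by lra; f_equal.
  destruct k; try apply sqrt_1; simpl; rewrite Rmult_1_r; apply sqrt_square; lra. }
rewrite <- K; transitivity (sgd * sgd * d); [rewrite hsgd|]; ring.
Qed.

(** The antiderivative is the logarithm of the radius, with c = 1: the factor rho'/rho cancels
    against the derivative rho / (gap rho') of [mu]. *)
Lemma lambda_parameter_exp (k : rot_type) (eps : R) (f : R -> R) (a b : Rbar)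
    (p q s : R -> R) (sg sgd : R) (I : R -> Prop) (mu : R -> R) (h : R -> R) :
  rotational_surface k eps a b p q s ->
  lambda_parameter k eps f a b p q s sg sgd I mu ->
  (forall t, I t -> h t = 1 / curvature_gap k eps f t) ->
  exp_integral I h (fun t => radius k p q s (mu t)).
Proof.
intros hM [hsg [hsgd H]] hh.
exists 1, (fun t => ln (radius k p q s (mu t))); split; [lra|].
assert (hr : forall t, I t -> 0 < radius k p q s (mu t)).
{ intros t ht; destruct (H t ht) as [hu _].
  apply (frame_of_surface _ _ _ _ _ _ _ _ hM hu). }
split; intros t ht; [|rewrite exp_ln; auto; ring].
rewrite hh by auto; destruct (H t ht) as [hu [hmu [hF [hd _]]]].
assert (hrt := hr t ht).
destruct (radius_derivable _ _ _ _ _ _ _ _ hM hu) as [hrd _].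
auto_derive; [repeat split; auto; eexists; eauto|].
eta_derive; rewrite (is_derive_unique _ _ _ hmu); field; repeat split; auto; try lra.
intros E; rewrite E in hd; lra.
Qed.

(** Common core of the angle formulas. In arc length the angle has derivative W c, with c up to sign
    the inverse square of the polar radius; the chain rule multiplies it by rho / (gap rho'), where
    W = [sg] t rho and rho' is [sgd] times the root. The sign [e] allows for the second hyperbolic
    family, whose gap is - (f + t). *)
Lemma lambda_parameter_angle (k : rot_type) (eps : R) (f : R -> R) (a b : Rbar)
    (p q s : R -> R) (sg sgd e : R) (I : R -> Prop) (mu psi c h : R -> R) :
  e * e = 1 ->
  rotational_surface k eps a b p q s ->
  lambda_parameter k eps f a b p q s sg sgd I mu ->
  (forall t, I t -> is_derive psi (mu t) (wronskian k p q s (mu t) * c t)) ->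
  (forall t, I t -> h t = e * (t * radius k p q s (mu t) ^ 2 * c t /
     (curvature_gap k eps f t *
      (sqrt (positivity_term k eps t (radius k p q s (mu t))) *
       match k with Parabolic => radius k p q s (mu t) | _ => 1 end)))) ->
  pm_integral I h (fun t => psi (mu t)).
Proof.
intros he hM hmu hpsi hh.
destruct hmu as [hsg [hsgd H]] eqn:E; clear E.
(* The orientation of N, the direction of growth of the radius and [e] merge into the single sign of
   the integral. *)
apply (pm_integral_of_derive _ _ _ (sg * sgd * e)).
{ apply sqr_eq_1; transitivity (sg * sg * (sgd * sgd) * (e * e)); [|rewrite hsg, hsgd, he]; ring. }
intros t ht; destruct (H t ht) as [hu [hd [hF [hp hw]]]].
destruct (lambda_parameter_sqrt _ _ _ _ _ _ _ _ _ _ _ _ t hM hmu ht) as [_ hroot].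
rewrite hh by auto.
set (m := sqrt _ * _) in *.
assert (hm : m <> 0) by (intros E; rewrite hroot, E in hp; lra).
replace (sg * sgd * e * _) with (radius k p q s (mu t) /
      (curvature_gap k eps f t * Derive (radius k p q s) (mu t)) *
   (wronskian k p q s (mu t) * c t)).
- apply (is_derive_comp psi mu); auto.
- rewrite hw, hroot; destruct (sqr_eq_1 _ hsgd) as [-> | ->], (sqr_eq_1 _ he) as [-> | ->]; field; auto.
Qed.

Lemma lambda_parameter_continuous (k : rot_type) (eps : R) (f : R -> R) (a b : Rbar)
    (p q s : R -> R) (sg sgd : R) (I : R -> Prop) (mu h : R -> R) (t : R) :
  lambda_parameter k eps f a b p q s sg sgd I mu -> I t ->
  C2_on (open_itv a b) h -> continuous (fun t => h (mu t)) t.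
Proof.
intros [_ [_ H]] ht hh; destruct (H t ht) as [hu [hd _]].
apply (continuous_comp mu h); apply @ex_derive_continuous; [eexists; eauto|apply hh, hu].
Qed.

(** Here x is the dominant coordinate: x^2 > y^2 keeps it from vanishing, so its sign is constant on
    the interval and serves as sigma. *)
Lemma lambda_parameter_hyperbolic_angle (k : rot_type) (eps : R) (f : R -> R) (a b al be : Rbar)
    (p q s : R -> R) (sg sgd : R) (mu x y c h : R -> R) :
  rotational_surface k eps a b p q s ->
  lambda_parameter k eps f a b p q s sg sgd (open_itv al be) mu ->
  C2_on (open_itv a b) x -> C2_on (open_itv a b) y ->
  (forall t, open_itv al be t -> 0 < x (mu t) ^ 2 - y (mu t) ^ 2 /\
     (x (mu t) * Derive y (mu t) - y (mu t) * Derive x (mu t)) /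
     (x (mu t) ^ 2 - y (mu t) ^ 2) = wronskian k p q s (mu t) * c t) ->
  (forall t, open_itv al be t -> h t = 1 * (t * radius k p q s (mu t) ^ 2 * c t /
     (curvature_gap k eps f t *
      (sqrt (positivity_term k eps t (radius k p q s (mu t))) *
       match k with Parabolic => radius k p q s (mu t) | _ => 1 end)))) ->
  exists (phi : R -> R) (sigma : R), (sigma = 1 \/ sigma = -1) /\
    pm_integral (open_itv al be) h phi /\
    forall t, open_itv al be t ->
      x (mu t) = sigma * (sqrt (x (mu t) ^ 2 - y (mu t) ^ 2) * cosh (phi t)) /\
      y (mu t) = sigma * (sqrt (x (mu t) ^ 2 - y (mu t) ^ 2) * sinh (phi t)).
Proof.
intros hM hmu hx hy hxy hh.
assert (hJ : forall t, open_itv al be t -> open_itv a b (mu t)) by (intros t ht; apply hmu, ht).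
destruct (sign_const al be (fun t => x (mu t))) as [sx [hsx hpos]].
{ intros t ht; eapply lambda_parameter_continuous; eauto. }
{ intros t ht E; destruct (hxy t ht) as [k1 _]; rewrite E in k1; nra. }
assert (hsx' : sx * sx = 1) by (destruct hsx as [-> | ->]; ring).
assert (K := fun t (ht : open_itv al be t) =>
  hyperbolic_angle x y sx (mu t) hsx' (proj1 (hx _ (hJ t ht))) (proj1 (hy _ (hJ t ht)))
  (hpos t ht) (proj1 (hxy t ht))).
set (psi := fun u => _) in K; cbv zeta in K.
exists (fun t => psi (mu t)), sx; split; [|split]; auto.
- apply (lambda_parameter_angle _ _ _ _ _ _ _ _ _ _ 1 _ _ psi c _ (Rmult_1_r 1) hM hmu); auto.
  intros t ht; destruct (hxy t ht) as [_ <-]; apply (K t ht).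
- intros t ht; apply (K t ht).
Qed.

(** From z^2 - w^2 = 1 - y^2, the dominant coordinate is z when y < 1 and w when y > 1. *)
Lemma spherical_lambda_profile (eps : R) (f : R -> R) (a b al be : Rbar)
    (p q s : R -> R) (sg sgd : R) (mu : R -> R) :
  rotational_surface Spherical eps a b p q s ->
  lambda_parameter Spherical eps f a b p q s sg sgd (open_itv al be) mu ->
  spherical_profile eps f (open_itv al be)
    (fun t => p (mu t)) (fun t => q (mu t)) (fun t => s (mu t)).
Proof.
intros hM hmu.
assert (hgap : forall t, curvature_gap Spherical eps f t = eps * f t - t)
  by (intros; unfold curvature_gap; simpl; ring).
assert (hJ : forall t, open_itv al be t -> open_itv a b (mu t)) by (intros t ht; apply hmu, ht).
assert (hc := hM); destruct hc as [_ [_ [hp [hq [hs [hc _]]]]]].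
assert (h1 : forall t, open_itv al be t -> p (mu t) ^ 2 + q (mu t) ^ 2 - s (mu t) ^ 2 = 1)
  by (intros t ht; apply (hc _ (hJ t ht))).
assert (hroot := fun t ht => lambda_parameter_sqrt _ _ _ _ _ _ _ _ _ _ _ _ t hM hmu ht).
assert (hF : forall t, open_itv al be t -> eps * f t - t <> 0)
  by (intros t ht; rewrite <- hgap; apply hmu, ht).
simpl in hroot.
pose (h := fun t => t * p (mu t) ^ 2 / ((p (mu t) ^ 2 - 1) * (eps * f t - t) *
    sqrt ((t ^ 2 - eps) * p (mu t) ^ 2 + eps))).
assert (hh : (forall t, open_itv al be t -> p (mu t) ^ 2 - 1 <> 0) ->
  forall t, open_itv al be t -> h t =
  1 * (t * p (mu t) ^ 2 * / (p (mu t) ^ 2 - 1) / (curvature_gap Spherical eps f t *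
    (sqrt (positivity_term Spherical eps t (p (mu t))) * 1)))).
{ intros hn t ht; generalize (hn t ht); unfold h; rewrite hgap; simpl; intros; field.
  repeat split; [nra|apply Rgt_not_eq, sqrt_lt_R0, hroot, ht|now apply hF|nra..]. }
unfold spherical_profile; cbv zeta; split; [|split; [|split]].
- apply (lambda_parameter_exp _ _ _ _ _ _ _ _ _ _ _ _ _ hM hmu).
  intros t _; now rewrite hgap.
- intros t ht; apply hroot, ht.
- intros hy.
  destruct (lambda_parameter_hyperbolic_angle _ _ _ _ _ _ _ _ _ _ _ _ _ q s
    (fun t => / (p (mu t) ^ 2 - 1)) h hM hmu hq hs) as [phi [sq [hsq [hphi hqs]]]].
  { intros t ht; assert (h1t := h1 t ht); assert (hyt := hy t ht); split; [nra|].
    replace (q (mu t) ^ 2 - s (mu t) ^ 2) with (- (p (mu t) ^ 2 - 1)) by lra.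
    unfold wronskian, det3; simpl; field; simpl; nra. }
  { apply hh; intros t ht; generalize (hy t ht); nra. }
  exists phi, sq; split; [|split]; [auto|exact hphi|].
  intros t ht; replace (1 - p (mu t) ^ 2) with (q (mu t) ^ 2 - s (mu t) ^ 2); auto.
  generalize (h1 t ht); lra.
(* With z and w exchanged, both the numerator of the angular derivative and its denominator change
   sign, so the factor 1 / (y^2 - 1) stays the same. *)
- intros hy.
  destruct (lambda_parameter_hyperbolic_angle _ _ _ _ _ _ _ _ _ _ _ _ _ s q
    (fun t => / (p (mu t) ^ 2 - 1)) h hM hmu hs hq) as [phi [sq [hsq [hphi hqs]]]].
  { intros t ht; assert (h1t := h1 t ht); assert (hyt := hy t ht); split; [nra|].
    replace (s (mu t) ^ 2 - q (mu t) ^ 2) with (p (mu t) ^ 2 - 1) by lra.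
    unfold wronskian, det3; simpl; field; simpl; nra. }
  { apply hh; intros t ht; generalize (hy t ht); nra. }
  exists phi, sq; split; [|split]; [auto|exact hphi|].
  intros t ht; replace (p (mu t) ^ 2 - 1) with (s (mu t) ^ 2 - q (mu t) ^ 2);
    [|generalize (h1 t ht); lra].
  destruct (hqs t ht); auto.
Qed.

(** The polar radius satisfies x^2 + y^2 = 1 + w^2 > 0, so a polar angle exists along the whole
    profile curve. *)
Lemma hyperbolic1_lambda_profile (eps : R) (f : R -> R) (a b al be : Rbar)
    (p q s : R -> R) (sg sgd : R) (mu : R -> R) :
  rotational_surface Hyperbolic1 eps a b p q s ->
  lambda_parameter Hyperbolic1 eps f a b p q s sg sgd (open_itv al be) mu ->
  hyperbolic1_profile eps f (open_itv al be)
    (fun t => p (mu t)) (fun t => q (mu t)) (fun t => s (mu t)).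
Proof.
intros hM hmu.
assert (hgap : forall t, curvature_gap Hyperbolic1 eps f t = eps * f t - t)
  by (intros; unfold curvature_gap; simpl; ring).
assert (hJ : forall t, open_itv al be t -> open_itv a b (mu t)) by (intros t ht; apply hmu, ht).
assert (hc := hM); destruct hc as [_ [_ [hp [hq [hs [hc _]]]]]].
assert (h1 : forall u, open_itv a b u -> 0 < s u /\ p u ^ 2 + q u ^ 2 = 1 + s u ^ 2).
{ intros u hu; destruct (hc u hu) as [k1 [k2 _]]; split; lra. }
assert (hroot := fun t ht => lambda_parameter_sqrt _ _ _ _ _ _ _ _ _ _ _ _ t hM hmu ht).
assert (hF : forall t, open_itv al be t -> eps * f t - t <> 0)
  by (intros t ht; rewrite <- hgap; apply hmu, ht).
simpl in hroot.
unfold hyperbolic1_profile; split; [|split; [|split]].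
- apply (lambda_parameter_exp _ _ _ _ _ _ _ _ _ _ _ _ _ hM hmu).
  intros t _; now rewrite hgap.
- intros t ht; apply hroot, ht.
- intros t ht; apply (h1 _ (hJ t ht)).
- destruct (polar_angle a b p q) as [psi hpsi].
  { intros u hu; destruct (hp u hu) as [k1 [k2 _]]; split; auto.
    now apply @ex_derive_continuous. }
  { intros u hu; destruct (hq u hu) as [k1 [k2 _]]; split; auto.
    now apply @ex_derive_continuous. }
  { intros u hu; destruct (h1 u hu) as [_ ->]; nra. }
  exists (fun t => psi (mu t)); split.
  + apply (lambda_parameter_angle _ _ _ _ _ _ _ _ _ _ 1 _ _ psi
      (fun t => / (1 + s (mu t) ^ 2)) _ (Rmult_1_r 1) hM hmu).
    * intros t ht; destruct (hpsi _ (hJ t ht)) as [d _].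
      destruct (h1 _ (hJ t ht)) as [_ E]; rewrite E in d.
      replace (wronskian _ _ _ _ _ * _) with
        ((p (mu t) * Derive q (mu t) - q (mu t) * Derive p (mu t)) /
         (1 + s (mu t) ^ 2)); auto.
      unfold wronskian, det3; simpl; field; simpl; nra.
    * intros t ht; rewrite hgap; simpl; field.
      repeat split; [nra|apply Rgt_not_eq, sqrt_lt_R0, hroot, ht|now apply hF|nra..].
  + intros t ht; destruct (h1 _ (hJ t ht)) as [_ E]; rewrite <- E; apply hpsi, hJ, ht.
Qed.

(** Here x^2 + y^2 = 1 - w^2, whose positivity comes from [positivity_term] and is thus obtained on
    the subinterval ]a', b'[ only; the polar angle is constructed there. *)
Lemma hyperbolic2_lambda_profile (eps : R) (f : R -> R) (a b a' b' al be : Rbar)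
    (p q s : R -> R) (sg sgd : R) (lam mu : R -> R) :
  rotational_surface Hyperbolic2 eps a b p q s ->
  (forall u, open_itv a' b' u -> open_itv a b u) ->
  change_of_parameter (open_itv a' b') lam al be mu ->
  lambda_parameter Hyperbolic2 eps f a b p q s sg sgd (open_itv al be) mu ->
  hyperbolic2_profile f (open_itv al be)
    (fun t => p (mu t)) (fun t => q (mu t)) (fun t => s (mu t)).
Proof.
intros hM hsub [hlam hmu'] hmu.
assert (hJ' : forall t, open_itv al be t -> open_itv a' b' (mu t))
  by (intros t ht; apply hmu', ht).
assert (hJ : forall t, open_itv al be t -> open_itv a b (mu t)) by auto.
assert (hc := hM); destruct hc as [_ [_ [hp [hq [hs [hc _]]]]]].
assert (h1 : forall u, open_itv a b u -> 0 < s u /\ p u ^ 2 + q u ^ 2 = 1 - s u ^ 2).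
{ intros u hu; destruct (hc u hu) as [k1 [k2 _]]; split; lra. }
assert (hgap : forall t, open_itv al be t -> curvature_gap Hyperbolic2 eps f t = - (f t + t)).
{ intros t ht; destruct (hc _ (hJ t ht)) as [_ [_ [[_ E] _]]].
  unfold curvature_gap; rewrite E; simpl; ring. }
assert (hroot := fun t ht => lambda_parameter_sqrt _ _ _ _ _ _ _ _ _ _ _ _ t hM hmu ht).
assert (hF : forall t, open_itv al be t -> f t + t <> 0).
{ intros t ht E; assert (hF : curvature_gap Hyperbolic2 eps f t <> 0) by apply hmu, ht.
  apply hF; rewrite hgap; auto; lra. }
simpl in hroot.
assert (hw : forall t, open_itv al be t -> 0 < s (mu t) < 1).
{ intros t ht; destruct (h1 _ (hJ t ht)) as [hst _]; split; auto.
  destruct (hroot t ht) as [hP _]; nra. }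
unfold hyperbolic2_profile; split; [|split; [|split]]; auto.
- apply (lambda_parameter_exp _ _ _ _ _ _ _ _ _ _ _ _ _ hM hmu).
  intros t ht; rewrite hgap; auto; field; auto.
- intros t ht; apply hroot, ht.
- destruct (polar_angle a' b' p q) as [psi hpsi].
  { intros u hu; destruct (hp u (hsub u hu)) as [k1 [k2 _]]; split; auto.
    now apply @ex_derive_continuous. }
  { intros u hu; destruct (hq u (hsub u hu)) as [k1 [k2 _]]; split; auto.
    now apply @ex_derive_continuous. }
  { intros u hu; destruct (h1 u (hsub u hu)) as [_ ->].
    (* Each u of the subinterval is [mu (lam u)], so the bound w < 1, obtained in the parameter t,
       transfers to u. *)
    destruct (hlam u hu) as [k1 [k2 _]]; generalize (hw _ k1); rewrite k2; intros; nra. }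
  exists (fun t => psi (mu t)); split.
  + apply (lambda_parameter_angle _ _ _ _ _ _ _ _ _ _ (-1) _ _ psi
      (fun t => / (1 - s (mu t) ^ 2)) _ ltac:(ring) hM hmu).
    * intros t ht; destruct (hpsi _ (hJ' t ht)) as [d _]; assert (hwt := hw t ht).
      destruct (h1 _ (hJ t ht)) as [_ E]; rewrite E in d.
      replace (wronskian _ _ _ _ _ * _) with
        ((p (mu t) * Derive q (mu t) - q (mu t) * Derive p (mu t)) /
         (1 - s (mu t) ^ 2)); auto.
      unfold wronskian, det3; simpl; field; simpl; nra.
    * intros t ht; rewrite hgap; auto; simpl; assert (hwt := hw t ht); field.
      repeat split; [nra|apply Rgt_not_eq, sqrt_lt_R0, hroot, ht|now apply hF|nra..].
  + intros t ht; destruct (h1 _ (hJ t ht)) as [_ E]; rewrite <- E; apply hpsi, hJ', ht.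
Qed.

(** The slope x / z plays the part of the angle: its derivative is W / z^2. The last coordinate w is
    solved from 2 z w + x^2 = 1. *)
Lemma parabolic_lambda_profile (eps : R) (f : R -> R) (a b al be : Rbar)
    (p q s : R -> R) (sg sgd : R) (mu : R -> R) :
  rotational_surface Parabolic eps a b p q s ->
  lambda_parameter Parabolic eps f a b p q s sg sgd (open_itv al be) mu ->
  parabolic_profile eps f (open_itv al be)
    (fun t => p (mu t)) (fun t => q (mu t)) (fun t => s (mu t)).
Proof.
intros hM hmu.
assert (hgap : forall t, curvature_gap Parabolic eps f t = eps * f t - t)
  by (intros; unfold curvature_gap; simpl; ring).
assert (hJ : forall t, open_itv al be t -> open_itv a b (mu t)) by (intros t ht; apply hmu, ht).
assert (hc := hM); destruct hc as [_ [_ [hp [hq [hs [hc _]]]]]].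
assert (h1 : forall t, open_itv al be t ->
  0 < q (mu t) /\ 2 * q (mu t) * s (mu t) + p (mu t) ^ 2 = 1).
{ intros t ht; destruct (hc _ (hJ t ht)) as [k1 [k2 _]]; auto. }
assert (hroot := fun t ht => lambda_parameter_sqrt _ _ _ _ _ _ _ _ _ _ _ _ t hM hmu ht).
assert (hF : forall t, open_itv al be t -> eps * f t - t <> 0)
  by (intros t ht; rewrite <- hgap; apply hmu, ht).
simpl in hroot.
unfold parabolic_profile; split; [|split; [|split]].
- apply (lambda_parameter_exp _ _ _ _ _ _ _ _ _ _ _ _ _ hM hmu).
  intros t _; now rewrite hgap.
- intros t ht; apply hroot, ht.
- intros t ht; apply (h1 t ht).
- exists (fun t => p (mu t) / q (mu t)); split.
  + apply (lambda_parameter_angle _ _ _ _ _ _ _ _ _ _ 1 _ _ (fun u => p u / q u)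
      (fun t => / q (mu t) ^ 2) _ (Rmult_1_r 1) hM hmu).
    * intros t ht; destruct (h1 t ht) as [hqt _].
      destruct (hp _ (hJ t ht)) as [k1 _], (hq _ (hJ t ht)) as [k2 _].
      auto_derive; [repeat split; auto; lra|].
      eta_derive; unfold wronskian, det3; simpl; field; lra.
    * intros t ht; destruct (h1 t ht) as [hqt _]; rewrite hgap; simpl; field.
      repeat split; [lra|apply Rgt_not_eq, sqrt_lt_R0, hroot, ht|now apply hF|lra..].
  + intros t ht; destruct (h1 t ht) as [hqt E]; split; [field; lra|].
    rewrite <- E; field; lra.
Qed.

(** The metric stays diagonal, and reparametrizing multiplies its profile entry by d^2 > 0; the
    signs of the two entries remain those of eps and [- form_disc k]. *)
Lemma causal_character_reparametrized (k : rot_type) (eps : R) (a b : Rbar)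
    (p q s mu : R -> R) (t v d : R) :
  rotational_surface k eps a b p q s -> open_itv a b (mu t) ->
  is_derive mu t d -> d <> 0 ->
  causal_character k eps
    (rot k (fun t => p (mu t)) (fun t => q (mu t)) (fun t => s (mu t))) t v.
Proof.
intros hM hu hd hn.
set (X := rot k (fun t => p (mu t)) (fun t => q (mu t)) (fun t => s (mu t))).
destruct (frame_of_surface _ _ _ _ _ _ _ _ hM hu) as [hr [_ [_ [h3 _]]]].
assert (hc := hM); destruct hc as [_ [_ [hp [hq [hs [hc _]]]]]].
assert (ex_derive mu t) by (eexists; eauto).
assert (hX : du X t v = emb k v (smul3 d
  (curve (Derive p) (Derive q) (Derive s) (mu t)))).
{ assert (K : forall h : R -> R, ex_derive h (mu t) ->
    ex_derive (fun t => h (mu t)) t /\ Derive (fun t => h (mu t)) t = d * Derive h (mu t)).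
  { intros h hh; rewrite <- (is_derive_unique _ _ _ hd); split.
    - now apply (ex_derive_comp h mu).
    - now apply (Derive_comp h mu). }
  destruct (K p (proj1 (hp _ hu))) as [p1 p2], (K q (proj1 (hq _ hu))) as [q1 q2],
    (K s (proj1 (hs _ hu))) as [s1 s2].
  unfold X; rewrite du_rot; auto; unfold curve, smul3; rewrite p2, q2, s2; reflexivity. }
assert (hY : dv X t v = smul4 (radius k p q s (mu t)) (tang k v))
  by (unfold X; rewrite dv_rot; now destruct k).
assert (E1 : g k (du X t v) (du X t v) = d ^ 2 * eps).
{ rewrite hX, g_emb, form_smul, form_sym, form_smul, h3; ring. }
assert (E2 : g k (du X t v) (dv X t v) = 0).
{ rewrite hX, hY, g_sym, g_smul, g_sym, g_emb_tang; ring. }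
assert (E3 : g k (dv X t v) (dv X t v) = - form_disc k * radius k p q s (mu t) ^ 2).
{ rewrite hY, g_smul, g_sym, g_smul, g_tang; ring. }
assert (hd2 : 0 < d ^ 2) by (apply pow2_gt_0; auto).
assert (hr2 : 0 < radius k p q s (mu t) ^ 2) by (apply pow2_gt_0; lra).
assert (hdr : 0 < d ^ 2 * radius k p q s (mu t) ^ 2) by now apply Rmult_lt_0_compat.
unfold causal_character, spacelike_at, timelike_at; rewrite E1, E2, E3.
assert (he : k = Hyperbolic2 -> eps = 1).
{ intros ->; apply (hc _ hu). }
destruct k; simpl form_disc in *; try (split; intros ->; nra).
rewrite he by reflexivity; nra.
Qed.

Theorem theorem3p1 (k : rot_type) (eps : R) (a b : Rbar) (p q s : R -> R)
    (N : R -> R -> vec4) (f : R -> R)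
    (hM : rotational_surface k eps a b p q s)
    (hN : unit_normal_field k (open_itv a b) (rot_range k) (rot k p q s) N)
    (hf : continuous_on
            (fun t => exists u v, open_itv a b u /\ rot_range k v /\
                        lambda k (rot k p q s) N u v = t) f)
    (hW : forall u v, open_itv a b u -> rot_range k v ->
            kappa k (rot k p q s) N u v = f (lambda k (rot k p q s) N u v))
    (humb : forall u v, open_itv a b u -> rot_range k v ->
              ~ umbilical_at k (rot k p q s) N u v) :
  let lam := fun u => lambda k (rot k p q s) N u 0 in
  (forall u v, open_itv a b u -> rot_range k v ->
     lambda k (rot k p q s) N u v = lam u) /\
  (forall u, open_itv a b u ->
     ex_derive lam u /\
     (Derive lam u <> 0 <->
      0 < positivity_term k eps (lam u) (radius k p q s u))) /\
  (forall a' b' : Rbar,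
     Rbar_le a a' -> Rbar_lt a' b' -> Rbar_le b' b ->
     (forall u, open_itv a' b' u -> Derive lam u <> 0) ->
     exists (al be : Rbar) (mu : R -> R) (P Q S : R -> R),
       change_of_parameter (open_itv a' b') lam al be mu /\
       lambda_profile k eps f (open_itv al be) P Q S /\
       forall t v, open_itv al be t -> rot_range k v ->
         rot k p q s (mu t) v = rot k P Q S t v /\
         causal_character k eps (rot k P Q S) t v).
Proof.
intros lam.
destruct (unit_normal_constant_sign _ _ _ _ _ _ _ _ hM hN) as [sg [hsg hsgN]].
assert (h0 := rot_range_0 k).
assert (hlam : forall u, open_itv a b u ->
  lam u = sg * wronskian k p q s u / radius k p q s u).
{ intros u hu; apply (lambda_eq k eps a b p q s N sg u 0); auto. }
assert (hd : forall u, open_itv a b u -> is_derive lam u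
  (curvature_gap k eps f (lam u) * Derive (radius k p q s) u / radius k p q s u)).
{ intros u hu; apply (lambda_derive k eps a b p q s N f sg u 0); auto. }
assert (hF : forall u, open_itv a b u -> curvature_gap k eps f (lam u) <> 0).
{ intros u hu; apply (curvature_gap_neq0 k eps a b p q s N f sg u 0); auto. }
assert (hr : forall u, open_itv a b u -> 0 < radius k p q s u).
{ intros u hu; apply (frame_of_surface _ _ _ _ _ _ _ _ hM hu). }
split; [|split].
- intros u v hu hv; rewrite hlam by auto.
  apply (lambda_eq k eps a b p q s N sg u v); auto.
- intros u hu; split; [eexists; eauto|].
  (* Both conditions amount to rho' <> 0: lambda' is rho' times the nonzero gap / rho, and rho'^2 is
     the positivity term times a positive factor. *)
  rewrite (is_derive_unique _ _ _ (hd u hu)).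
  assert (hs := radius_derive_positivity _ _ _ _ _ _ _ sg _ u hM hu hsg (hlam u hu)).
  assert (hru := hr u hu); assert (hFu := hF u hu).
  set (P := positivity_term _ _ _ _) in *; set (d := Derive _ u) in *.
  assert (hm : 0 < match k with Parabolic => radius k p q s u ^ 2 | _ => 1 end)
    by (destruct k; try lra; apply pow2_gt_0; lra).
  set (m := match k with Parabolic => _ | _ => _ end) in *.
  split; intros h.
  + apply (Rmult_lt_reg_r m); auto; rewrite Rmult_0_l, <- hs; apply pow2_gt_0.
    intros E; apply h; rewrite E; field; lra.
  + assert (hd0 : d <> 0).
    { intros E; rewrite E in hs; assert (0 < P * m) by now apply Rmult_lt_0_compat.
      rewrite <- hs in *; lra. }
    unfold Rdiv; repeat apply Rmult_integral_contrapositive_currified; auto.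
    apply Rinv_neq_0_compat; lra.
- intros a' b' ha hab hb hcrit.
  assert (hsub : forall u, open_itv a' b' u -> open_itv a b u).
  { intros u [h1 h2]; split; [now apply Rbar_le_lt_trans with a'
      |now apply Rbar_lt_le_trans with b']. }
  destruct (inverse_monotone a' b' lam) as [al [be [mu hmu]]]; auto.
  { intros u hu; eexists; apply hd; auto. }
  { intros u hu; apply (lambda_derive_continuous k eps a b p q s N sg u 0); auto. }
  (* A zero of rho' would be a critical point of lambda, so rho' keeps one sign on the
     subinterval. *)
  destruct (sign_const a' b' (Derive (radius k p q s))) as [sgd [hsgd hpos]].
  { intros u hu; apply @ex_derive_continuous.
    apply (radius_derivable _ _ _ _ _ _ _ u hM); auto. }
  { intros u hu E; apply (hcrit u hu).
    rewrite (is_derive_unique _ _ _ (hd u (hsub u hu))), E; unfold Rdiv; ring. }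
  assert (hI : forall t, open_itv al be t -> open_itv a' b' (mu t) /\ lam (mu t) = t /\
    is_derive mu t (/ Derive lam (mu t))).
  { intros t ht; destruct hmu as [H1 H2] eqn:E; destruct (H2 t ht) as [k1 [k2 _]].
    split; [|split]; auto; eapply change_of_parameter_derive; eauto. }
  assert (hpar : lambda_parameter k eps f a b p q s sg sgd (open_itv al be) mu).
  { split; [|split]; auto; [destruct hsgd as [-> | ->]; ring|].
    intros t ht; destruct (hI t ht) as [hu [ht' hdmu]]; assert (hu' := hsub _ hu).
    assert (hFt := hF _ hu'); rewrite ht' in hFt; assert (hrt := hr _ hu').
    assert (hpt := hpos _ hu).
    split; [|split; [|split; [|split]]]; auto.
    - rewrite (is_derive_unique _ _ _ (hd _ hu')), ht' in hdmu.
      replace (radius k p q s (mu t) / _) with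
        (/ (curvature_gap k eps f t * Derive (radius k p q s) (mu t) /
         radius k p q s (mu t))); auto.
      field; repeat split; auto; try lra.
      intros E; rewrite E in hpt; lra.
    - rewrite <- ht' at 2; rewrite hlam by auto.
      transitivity (sg * sg * wronskian k p q s (mu t)); [rewrite hsg; ring|field; lra]. }
  (* The new profile functions are the old ones composed with [mu], so the two parameterizations
     agree pointwise by construction. *)
  exists al, be, mu, (fun t => p (mu t)), (fun t => q (mu t)), (fun t => s (mu t)).
  split; [|split]; auto.
  + destruct k; simpl.
    * eapply spherical_lambda_profile; eauto.
    * eapply hyperbolic1_lambda_profile; eauto.
    * eapply hyperbolic2_lambda_profile; eauto.
    * eapply parabolic_lambda_profile; eauto.
  + intros t v ht hv; split; [now destruct k|].
    destruct (hI t ht) as [hu [_ hdmu]].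
    eapply causal_character_reparametrized; eauto.
    apply Rinv_neq_0_compat; auto.
Qed.
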